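(* Let $g:\mathbb{N}\to\mathbb{C}$ be an arithmetic function such that for every $\varepsilon>0$ one has $g(n)\ll_\varepsilon n^\varepsilon$ for all $n\geq 1$, and let $f=\mathrm{id}\ast g$, i.e. $f(n)=\sum_{d\mid n} d\, g(n/d)$. Then for any $\varepsilon>0$, \[ \sum_{n\leq x}\frac{f([x/n])}{[x/n]}= x\sum_{m\geq1}\frac{f(m)}{m^2(m+1)}+O(x^{1/3+\varepsilon}) \] as $x\rightarrow\infty$.
   Context: $[t]$ denotes the integral part of the real number $t$; $\mathrm{id}(n)=n$ for $n\ge1$, and $\ast$ denotes Dirichlet convolution. The implied constant may depend on $\varepsilon$. *)

(* Defs.v *)
From Stdlib Require Import Reals Lra Lia ZArith Arith List.
From Coquelicot Require Export Coquelicot.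
Open Scope R_scope.

Definition nfloor (t : R) : nat := Z.to_nat (Int_part t).

Definition id_conv (g : nat -> C) (n : nat) : C :=
  fold_right Cplus (RtoC 0)
    (map (fun d => if Nat.eqb (n mod d)%nat 0%nat
                   then Cmult (RtoC (INR d)) (g (n / d)%nat)
                   else RtoC 0)
         (seq 1 n)).

Definition floor_sum (f : nat -> C) (x : R) : C :=
  fold_right Cplus (RtoC 0)
    (map (fun n => let k := nfloor (x / INR n) in Cdiv (f k) (RtoC (INR k)))
         (seq 1 (nfloor x))).

(* Main.v *)
Require Import Defs.
From Stdlib Require Import Reals Lra Lia ZArith Znumtheory List Permutation FinFun.
From Coquelicot Require Import Coquelicot.
Open Scope R_scope.

(* Since f(m)/m = sum_{d | m} g(d)/d, the sum on the left is
   sum_d (g(d)/d) T_d, where T_d counts the n <= x with d | [x/n], and the main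
   term is the same combination of the densities x sum_{d | m} 1/(m(m+1)).
   As g(d) << d^(1/6), it suffices to compare T_d with its density up to
   O(x^(1/3+eps) d^(-1/3)).  Splitting at n = sqrt(x/d), the hyperbola method
   expresses the difference by sums of psi(y/(n+al) - b), with y = x/d,
   psi(u) = {u} - 1/2 and n + al <= sqrt y.

   Such a sum is O(Y^(1+eps)) with Y = y^(1/3).  At v = n + al the slope y/v^2 has a
   rational approximation a/q with q <= v/Y and |q y - a v^2| <= Y v; on the next
   q integers the summand is close to an arithmetic progression of difference a/q
   modulo 1, so the block contributes O(1).  To count blocks, charge 1/q to each
   integer of a block.  An integer v is charged for (a,q) only if
   |q y - a v^2| <= 5 Y v, and two such v, v' satisfy a |v - v'| <= 5 Y, so the
   number of blocks is at most sum_{a, q << Y} (1/q) (1 + 5 Y/a) << Y log^2 Y. *)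

(** * Finite sums over lists *)

Definition rsum {A : Type} (F : A -> R) (l : list A) : R :=
  fold_right Rplus 0 (map F l).

Lemma rsum_cons {A} (F : A -> R) x l : rsum F (x :: l) = F x + rsum F l.
Proof. reflexivity. Qed.

Lemma rsum_app {A} (F : A -> R) l l' : rsum F (l ++ l') = rsum F l + rsum F l'.
Proof.
  induction l as [|x l IH]; simpl; [unfold rsum; simpl; ring|].
  rewrite !rsum_cons, IH; ring.
Qed.

Lemma rsum_ext {A} (F G : A -> R) l :
  (forall x, In x l -> F x = G x) -> rsum F l = rsum G l.
Proof.
  induction l as [|x l IH]; intros H; [reflexivity|].
  rewrite !rsum_cons, IH, H; auto using in_eq, in_cons.
Qed.

Lemma rsum_le {A} (F G : A -> R) l :
  (forall x, In x l -> F x <= G x) -> rsum F l <= rsum G l.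
Proof.
  induction l as [|x l IH]; intros H; [apply Rle_refl|].
  rewrite !rsum_cons; apply Rplus_le_compat; auto using in_eq, in_cons.
Qed.

Lemma rsum_plus {A} (F G : A -> R) l :
  rsum (fun x => F x + G x) l = rsum F l + rsum G l.
Proof.
  induction l as [|x l IH]; [unfold rsum; simpl; ring|].
  rewrite !rsum_cons, IH; ring.
Qed.

Lemma rsum_scal {A} (c : R) (F : A -> R) l :
  rsum (fun x => c * F x) l = c * rsum F l.
Proof.
  induction l as [|x l IH]; [unfold rsum; simpl; ring|].
  rewrite !rsum_cons, IH; ring.
Qed.

Lemma rsum_minus {A} (F G : A -> R) l :
  rsum (fun x => F x - G x) l = rsum F l - rsum G l.
Proof.
  induction l as [|x l IH]; [unfold rsum; simpl; ring|].
  rewrite !rsum_cons, IH; ring.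
Qed.

Lemma rsum_const {A} (c : R) (l : list A) : rsum (fun _ => c) l = INR (length l) * c.
Proof.
  induction l as [|x l IH]; [unfold rsum; simpl; ring|].
  rewrite rsum_cons, IH; simpl length; rewrite S_INR; ring.
Qed.

Lemma rsum_switch {A B} (F : A -> B -> R) l l' :
  rsum (fun x => rsum (F x) l') l = rsum (fun y => rsum (fun x => F x y) l) l'.
Proof.
  induction l as [|x l IH].
  - unfold rsum at 1; simpl; symmetry.
    rewrite (rsum_ext _ (fun _ => 0)) by reflexivity.
    rewrite rsum_const; ring.
  - rewrite rsum_cons, IH, <- rsum_plus; reflexivity.
Qed.

Lemma rsum_permutation {A} (F : A -> R) l l' :
  Permutation l l' -> rsum F l = rsum F l'.
Proof.
  induction 1; try reflexivity.
  - rewrite !rsum_cons; congruence.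
  - rewrite !rsum_cons; ring.
  - congruence.
Qed.

Lemma rsum_map {A B} (F : B -> R) (h : A -> B) l :
  rsum F (map h l) = rsum (fun x => F (h x)) l.
Proof. unfold rsum; rewrite map_map; reflexivity. Qed.

Lemma rsum_abs {A} (F : A -> R) l : Rabs (rsum F l) <= rsum (fun x => Rabs (F x)) l.
Proof.
  induction l as [|x l IH]; [unfold rsum; simpl; rewrite Rabs_R0; lra|].
  rewrite !rsum_cons; eapply Rle_trans; [apply Rabs_triang|lra].
Qed.

Lemma rsum_nonneg {A} (F : A -> R) l : (forall x, In x l -> 0 <= F x) -> 0 <= rsum F l.
Proof.
  intros H; replace 0 with (rsum (fun _ : A => 0) l) by (rewrite rsum_const; ring).
  apply rsum_le, H.
Qed.

Lemma rsum_seq_S (F : nat -> R) A n :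
  rsum F (seq A (S n)) = rsum F (seq A n) + F (A + n)%nat.
Proof. rewrite seq_S, rsum_app; unfold rsum at 2; simpl; ring. Qed.

Lemma rsum_seq_shift (F : nat -> R) A n :
  rsum F (seq A n) = rsum (fun t => F (A + t)%nat) (seq 0 n).
Proof.
  induction n as [|n IH]; [reflexivity|].
  rewrite !rsum_seq_S, IH; reflexivity.
Qed.

Lemma rsum_INR_seq n : rsum INR (seq 0 n) = INR n * (INR n - 1) / 2.
Proof.
  induction n as [|n IH]; [unfold rsum; simpl; lra|].
  rewrite rsum_seq_S, IH, S_INR; simpl; lra.
Qed.

(** * Sums of psi along a hyperbola *)

(** Farey neighbours [a / b] and [c / d] of order [N] around [t], built by inserting mediants as [N]
    grows. *)
Lemma neighbouring_fractions (t : R) (N : nat) : (1 <= N)%nat ->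
  exists a b c d : Z,
    (0 < b <= Z.of_nat N)%Z /\ (0 < d <= Z.of_nat N)%Z /\ (Z.of_nat N < b + d)%Z /\
    (b * c - a * d = 1)%Z /\ IZR a <= t * IZR b /\ t * IZR d <= IZR c.
Proof.
  induction 1 as [|N HN IH].
  - exists (Int_part t), 1%Z, (Int_part t + 1)%Z, 1%Z.
    destruct (base_Int_part t) as [H1 H2].
    rewrite plus_IZR; repeat split; try lia; lra.
  - destruct IH as (a & b & c & d & Hb & Hd & Hbd & Hdet & Ha & Hc).
    (* The mediant has denominator [b + d > N], so it enters at this stage only if [b + d = N + 1];
       it then replaces the endpoint on its own side of [t]. *)
    destruct (Z.eq_dec (b + d) (Z.of_nat (S N))) as [E|E].
    + destruct (Rle_dec (IZR (a + c)) (t * IZR (b + d))) as [L|L].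
      * exists (a + c)%Z, (b + d)%Z, c, d; repeat split; try lia; assumption.
      * exists a, b, (a + c)%Z, (b + d)%Z; repeat split; try lia; lra.
    + exists a, b, c, d; repeat split; try lia; assumption.
Qed.

(** The mediant separates two cases; in each, the endpoint on the same side as [t] is a good enough
    approximation because [b + d >= N + 1]. Coprimality is read off the determinant
    [b c - a d = 1]. *)
Lemma dirichlet_approximation (t : R) (N : nat) : (1 <= N)%nat ->
  exists a q : Z, (0 < q <= Z.of_nat N)%Z /\ rel_prime a q /\
    Rabs (t * IZR q - IZR a) * (INR N + 1) <= 1.
Proof.
  intros HN.
  destruct (neighbouring_fractions t N HN)
    as (a & b & c & d & Hb & Hd & Hbd & Hdet & Ha & Hc).
  assert (HNR : INR N + 1 <= IZR b + IZR d).
  { rewrite INR_IZR_INZ, <- !plus_IZR; apply IZR_le; lia. }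
  assert (HD : IZR b * IZR c - IZR a * IZR d = 1).
  { rewrite <- !mult_IZR, <- minus_IZR, Hdet; reflexivity. }
  assert (Hb0 : 0 < IZR b) by (apply IZR_lt; lia).
  assert (Hd0 : 0 < IZR d) by (apply IZR_lt; lia).
  pose proof (pos_INR N) as HN0.
  destruct (Rle_dec (t * (IZR b + IZR d)) (IZR a + IZR c)) as [L|L].
  - exists a, b; split; [exact Hb|split].
    + apply bezout_rel_prime, (Bezout_intro _ _ _ (- d) c); lia.
    + rewrite Rabs_pos_eq by lra.
      (* From [t (b + d) <= a + c] one gets [(t b - a) (b + d) <= b (a + c) - a (b + d) = 1]. *)
      apply Rle_trans with ((t * IZR b - IZR a) * (IZR b + IZR d)); nra.
  - exists c, d; split; [exact Hd|split].
    + apply bezout_rel_prime, (Bezout_intro _ _ _ b (- a)); lia.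
    + rewrite Rabs_left1 by lra.
      apply Rle_trans with (- (t * IZR d - IZR c) * (IZR b + IZR d)); nra.
Qed.

(** Since [a] is invertible modulo [q], the residues permute 0, ..., q - 1. *)
Lemma rsum_complete_residues (a J : Z) (q : nat) : (0 < q)%nat ->
  rel_prime a (Z.of_nat q) ->
  rsum (fun t => IZR ((J - a * Z.of_nat t) mod Z.of_nat q)) (seq 0 q)
  = INR q * (INR q - 1) / 2.
Proof.
  intros Hq Haq.
  set (res := fun t => Z.to_nat ((J - a * Z.of_nat t) mod Z.of_nat q)).
  assert (Hb : forall t, (0 <= (J - a * Z.of_nat t) mod Z.of_nat q < Z.of_nat q)%Z)
    by (intros t; apply Z.mod_pos_bound; lia).
  rewrite (rsum_ext _ (fun t => INR (res t))).
  2:{ intros t _; unfold res; rewrite INR_IZR_INZ, Z2Nat.id by apply Hb; reflexivity. }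
  rewrite <- rsum_map, <- rsum_INR_seq.
  (* Distinctness, equal length and inclusion in 0, ..., q - 1 suffice for a permutation. *)
  apply rsum_permutation, NoDup_Permutation_bis.
  - apply Injective_map_NoDup_in; [|apply seq_NoDup].
    intros s t Hs Ht E; apply in_seq in Hs, Ht; unfold res in E.
    apply Z2Nat.inj in E; try apply Hb.
    assert (D : (Z.of_nat q | a * (Z.of_nat t - Z.of_nat s))%Z).
    { replace (a * (Z.of_nat t - Z.of_nat s))%Z
        with ((J - a * Z.of_nat s) - (J - a * Z.of_nat t))%Z by ring.
      apply Z.mod_divide; [lia|].
      rewrite Zminus_mod, E, Z.sub_diag; reflexivity. }
    apply Gauss in D; [|apply rel_prime_sym, Haq].
    destruct D as [k Hk].
    assert (k = 0)%Z by nia. nia.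
  - rewrite length_map; lia.
  - intros x Hx; apply in_map_iff in Hx; destruct Hx as [t [<- _]].
    apply in_seq; unfold res; specialize (Hb t); lia.
Qed.

(** * The sawtooth function near a rational progression *)

Definition psi (u : R) : R := frac_part u - 1 / 2.

Lemma Int_part_eq (u : R) (z : Z) : IZR z <= u < IZR z + 1 -> Int_part u = z.
Proof. intros H; symmetry; apply Int_part_spec; lra. Qed.

Lemma psi_bound (u : R) : Rabs (psi u) <= 1 / 2.
Proof. unfold psi; destruct (base_fp u); apply Rabs_le; lra. Qed.

(** The function [psi u - u] is nonincreasing, being minus the integral part up to a constant; the
    jumps of [psi] therefore do no harm. *)
Lemma psi_perturb (u lo hi : R) : lo <= u <= hi ->
  psi hi - (hi - lo) <= psi u <= psi lo + (hi - lo).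
Proof.
  intros H; unfold psi, frac_part.
  destruct (base_Int_part u), (base_Int_part lo), (base_Int_part hi).
  assert (Int_part lo <= Int_part u)%Z
    by (apply Z.lt_succ_r, lt_IZR; rewrite succ_IZR; lra).
  assert (Int_part u <= Int_part hi)%Z
    by (apply Z.lt_succ_r, lt_IZR; rewrite succ_IZR; lra).
  assert (IZR (Int_part lo) <= IZR (Int_part u)) by (apply IZR_le; assumption).
  assert (IZR (Int_part u) <= IZR (Int_part hi)) by (apply IZR_le; assumption).
  lra.
Qed.

(** With [c q = J + r] and [0 <= r < 1], the fractional parts are [((J - a t) mod q + r) / q], and
    the sum is exactly [r - 1 / 2]. *)
Lemma psi_rational_progression (a : Z) (q : nat) (c : R) : (0 < q)%nat ->
  rel_prime a (Z.of_nat q) ->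
  Rabs (rsum (fun t => psi (c - IZR a * INR t / INR q)) (seq 0 q)) <= 1 / 2.
Proof.
  intros Hq Haq.
  set (J := Int_part (c * INR q)). set (r := c * INR q - IZR J).
  assert (Hq0 : 0 < INR q) by (apply lt_0_INR; exact Hq).
  assert (Hr : 0 <= r < 1) by (unfold r, J; destruct (base_Int_part (c * INR q)); lra).
  rewrite (rsum_ext _ (fun t => / INR q * IZR ((J - a * Z.of_nat t) mod Z.of_nat q)
                                + (r / INR q - 1 / 2))).
  - rewrite rsum_plus, rsum_scal, rsum_complete_residues, rsum_const, length_seq by assumption.
    replace (/ INR q * (INR q * (INR q - 1) / 2) + INR q * (r / INR q - 1 / 2))
      with (r - 1 / 2) by (field; lra).
    apply Rabs_le; lra.
  - intros t _.
    set (w := (J - a * Z.of_nat t)%Z).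
    pose proof (Z.div_mod w (Z.of_nat q) ltac:(lia)) as Hdm.
    pose proof (Z.mod_pos_bound w (Z.of_nat q) ltac:(lia)) as Hm.
    set (k := (w / Z.of_nat q)%Z) in *. set (m := (w mod Z.of_nat q)%Z) in *.
    assert (Hw : IZR J - IZR a * INR t = INR q * IZR k + IZR m).
    { rewrite (INR_IZR_INZ q), (INR_IZR_INZ t), <- !mult_IZR, <- minus_IZR, <- plus_IZR, <- Hdm.
      reflexivity. }
    assert (Hm0 : 0 <= IZR m) by (apply IZR_le; lia).
    assert (Hm1 : IZR m + 1 <= INR q)
      by (rewrite INR_IZR_INZ, <- plus_IZR; apply IZR_le; lia).
    assert (E : c - IZR a * INR t / INR q = IZR k + (IZR m + r) / INR q).
    { replace c with ((IZR J + r) / INR q) by (unfold r; field; lra).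
      replace (IZR J) with (INR q * IZR k + IZR m + IZR a * INR t) by lra.
      field; lra. }
    assert (F : 0 <= (IZR m + r) / INR q < 1).
    { split; [apply Rdiv_le_0_compat; lra|].
      apply Rmult_lt_reg_r with (INR q); [lra|].
      unfold Rdiv; rewrite Rmult_assoc, Rinv_l by lra; lra. }
    unfold psi, frac_part; rewrite E, (Int_part_eq _ k) by lra.
    field; lra.
Qed.

(** Each [psi (u t)] is squeezed between its values on the progression shifted down and up by
    [e / q]; the gap [2 e / q] costs [2 e] over the [q] terms. *)
Lemma psi_near_progression (a : Z) (q : nat) (c e : R) (u : nat -> R) : (0 < q)%nat ->
  rel_prime a (Z.of_nat q) ->
  (forall t, (t < q)%nat -> Rabs (u t - (c - IZR a * INR t / INR q)) <= e / INR q) ->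
  Rabs (rsum (fun t => psi (u t)) (seq 0 q)) <= 1 / 2 + 2 * e.
Proof.
  intros Hq Haq Hu.
  assert (Hq0 : 0 < INR q) by (apply lt_0_INR; exact Hq).
  pose proof (psi_rational_progression a q (c - e / INR q) Hq Haq) as H1.
  pose proof (psi_rational_progression a q (c + e / INR q) Hq Haq) as H2.
  assert (E : rsum (fun _ : nat => 2 * e / INR q) (seq 0 q) = 2 * e)
    by (rewrite rsum_const, length_seq; field; lra).
  assert (B : forall t, In t (seq 0 q) ->
    psi (c + e / INR q - IZR a * INR t / INR q) - 2 * e / INR q <= psi (u t)
      <= psi (c - e / INR q - IZR a * INR t / INR q) + 2 * e / INR q).
  { intros t Ht; apply in_seq in Ht.
    pose proof (Hu t ltac:(lia)) as Hut; apply Rabs_le_between in Hut.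
    destruct (psi_perturb (u t) (c - e / INR q - IZR a * INR t / INR q)
                (c + e / INR q - IZR a * INR t / INR q)); [lra|].
    lra. }
  pose proof (rsum_le _ _ _ (fun t Ht => proj1 (B t Ht))) as L.
  pose proof (rsum_le _ _ _ (fun t Ht => proj2 (B t Ht))) as U.
  rewrite rsum_minus, E in L. rewrite rsum_plus, E in U.
  apply Rabs_le_between in H1, H2.
  apply Rabs_le; lra.
Qed.

(** * Linear blocks of the hyperbola and the charging of rational slopes *)

Lemma rsum_ge_term {A} (F : A -> R) l x :
  (forall z, In z l -> 0 <= F z) -> In x l -> F x <= rsum F l.
Proof.
  induction l as [|z l IH]; intros H Hx; [destruct Hx|].
  rewrite rsum_cons; destruct Hx as [<-|Hx].
  - pose proof (rsum_nonneg F l (fun w Hw => H w (in_cons _ _ _ Hw))); lra.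
  - specialize (IH (fun w Hw => H w (in_cons _ _ _ Hw)) Hx).
    pose proof (H z (in_eq _ _)); lra.
Qed.

Lemma rsum_indicator_spread (F : nat -> R) (A len : nat) (D : R) : 0 <= D ->
  (forall n, F n = 0 \/ F n = 1) ->
  (forall m n, (A <= m <= n)%nat -> F m = 1 -> F n = 1 -> INR n - INR m <= D) ->
  rsum F (seq A len) <= 1 + D.
Proof.
  intros HD H01 Hsp.
  (* The induction keeps track of the first and the last integer where [F] is 1. *)
  assert (K : rsum F (seq A len) = 0 \/
    exists m n, (A <= m <= n)%nat /\ (n < A + len)%nat /\ F m = 1 /\ F n = 1 /\
      rsum F (seq A len) <= 1 + INR n - INR m).
  { induction len as [|len IH]; [left; reflexivity|].
    rewrite rsum_seq_S.
    destruct (H01 (A + len)%nat) as [E|E]; rewrite E.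
    - destruct IH as [IH|(m & n & H1 & H2 & H3 & H4 & H5)]; [left; lra|right].
      exists m, n; repeat split; try lia; try assumption; lra.
    - right; destruct IH as [IH|(m & n & H1 & H2 & H3 & H4 & H5)].
      + exists (A + len)%nat, (A + len)%nat; repeat split; try lia; try assumption; lra.
      + exists m, (A + len)%nat; repeat split; try lia; try assumption.
        assert (INR n + 1 <= INR (A + len)) by (rewrite <- S_INR; apply le_INR; lia).
        lra. }
  destruct K as [K|(m & n & H1 & H2 & H3 & H4 & H5)]; [lra|].
  specialize (Hsp m n H1 H3 H4); lra.
Qed.

(** Taylor expansion of [Y^3 / (v + t)] at [t = 0]. After multiplication by [q], replacing the slope
    by [a / q] costs at most [q Y / v <= 1], and the quadratic remainder is at most
    [(q Y / v)^3 <= 1]. *)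
Lemma hyperbola_linearization (Y v b : R) (a : Z) (q t : nat) :
  0 < Y -> 0 < v -> (t < q)%nat -> INR q * Y <= v ->
  Rabs (INR q * Y ^ 3 - IZR a * v ^ 2) <= Y * v ->
  Rabs (Y ^ 3 / (v + INR t) - b - (Y ^ 3 / v - b - IZR a * INR t / INR q)) <= 2 / INR q.
Proof.
  intros HY Hv Htq HqY Ha.
  assert (Hq : 0 < INR q) by (apply lt_0_INR; lia).
  assert (Ht0 : 0 <= INR t) by apply pos_INR.
  assert (Ht : INR t <= INR q) by (apply le_INR; lia).
  replace (Y ^ 3 / (v + INR t) - b - (Y ^ 3 / v - b - IZR a * INR t / INR q))
    with (/ INR q * (INR t * (- (INR q * Y ^ 3 - IZR a * v ^ 2)) / v ^ 2
          + INR q * Y ^ 3 * INR t ^ 2 / (v ^ 2 * (v + INR t))))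
    by (field; repeat split; lra).
  rewrite Rabs_mult, (Rabs_pos_eq (/ INR q)) by (left; apply Rinv_0_lt_compat; exact Hq).
  unfold Rdiv at 3; rewrite Rmult_comm; apply Rmult_le_compat_r;
    [left; apply Rinv_0_lt_compat; exact Hq|].
  assert (Hv2 : 0 < v ^ 2) by (apply pow_lt; exact Hv).
  eapply Rle_trans; [apply Rabs_triang|].
  assert (B1 : Rabs (INR t * - (INR q * Y ^ 3 - IZR a * v ^ 2) / v ^ 2) <= 1).
  { unfold Rdiv; rewrite !Rabs_mult, Rabs_Ropp, (Rabs_pos_eq (INR t)) by exact Ht0.
    rewrite (Rabs_pos_eq (/ v ^ 2)) by (left; apply Rinv_0_lt_compat; exact Hv2).
    apply Rmult_le_reg_r with (v ^ 2); [exact Hv2|].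
    rewrite Rmult_assoc, Rinv_l by lra.
    apply Rle_trans with (INR q * (Y * v)); [|nra].
    rewrite Rmult_1_r; apply Rmult_le_compat; auto using Rabs_pos. }
  assert (B2 : Rabs (INR q * Y ^ 3 * INR t ^ 2 / (v ^ 2 * (v + INR t))) <= 1).
  { assert (0 < v ^ 2 * (v + INR t)) by (apply Rmult_lt_0_compat; lra).
    assert (Hn : 0 <= INR q * Y ^ 3 * INR t ^ 2)
      by (apply Rmult_le_pos; [apply Rmult_le_pos; [lra|apply pow_le; lra]|apply pow_le; lra]).
    rewrite Rabs_pos_eq by (apply Rdiv_le_0_compat; assumption).
    apply Rle_div_l; [assumption|].
    apply Rle_trans with ((INR q * Y) ^ 3).
    - replace ((INR q * Y) ^ 3) with (INR q * Y ^ 3 * INR q ^ 2) by ring.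
      apply Rmult_le_compat_l; [apply Rmult_le_pos; [lra|apply pow_le; lra]|].
      apply pow_incr; lra.
    - apply Rle_trans with (v ^ 3); [apply pow_incr; split; nra|].
      simpl; nra. }
  lra.
Qed.

(* Says that the tangent slope [Y^3 / v^2] of the hyperbola is close to [a / q]. *)
Definition near (Y : R) (a q : nat) (v : R) : R :=
  if Rle_dec (Rabs (INR q * Y ^ 3 - INR a * v ^ 2)) (5 * Y * v) then 1 else 0.

(** Total charge that an integer at [v] can receive, over all pairs [a], [q] up to [P], coprime or
    not. It does not depend on the choice of blocks, so it can be summed over [v] directly. *)
Definition slope_weight (Y : R) (P : nat) (v : R) : R :=
  rsum (fun q => / INR q * rsum (fun a => near Y a q v) (seq 1 P)) (seq 1 P).

Lemma near_01 Y a q v : near Y a q v = 0 \/ near Y a q v = 1.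
Proof. unfold near; destruct Rle_dec; auto. Qed.

Lemma near_pos Y a q v : 0 <= near Y a q v.
Proof. destruct (near_01 Y a q v) as [->| ->]; lra. Qed.

Lemma slope_weight_ge Y P v a q : (1 <= a <= P)%nat -> (1 <= q <= P)%nat ->
  near Y a q v = 1 -> / INR q <= slope_weight Y P v.
Proof.
  intros Ha Hq Hn.
  assert (Hi : forall z, In z (seq 1 P) -> 0 <= / INR z).
  { intros z Hz; apply in_seq in Hz; left; apply Rinv_0_lt_compat, lt_0_INR; lia. }
  apply Rle_trans with (/ INR q * rsum (fun a => near Y a q v) (seq 1 P)).
  - rewrite <- (Rmult_1_r (/ INR q)) at 1.
    apply Rmult_le_compat_l; [apply Hi, in_seq; lia|].
    rewrite <- Hn.
    apply (rsum_ge_term (fun a => near Y a q v)); [intros; apply near_pos|apply in_seq; lia].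
  - unfold slope_weight.
    apply (rsum_ge_term (fun q => / INR q * rsum (fun a => near Y a q v) (seq 1 P)));
      [|apply in_seq; lia].
    intros z Hz; apply Rmult_le_pos; [apply Hi, Hz|].
    apply rsum_nonneg; intros; apply near_pos.
Qed.

(** Subtracting the conditions at [v] and [v'] gives [a |v^2 - v'^2| <= 5 Y (v + v')]; dividing by
    [v + v'] bounds the spread of the admissible integers. *)
Lemma rsum_near_le Y a q al A len : 0 <= Y -> (1 <= a)%nat -> (1 <= A)%nat -> 0 <= al ->
  rsum (fun n => near Y a q (INR n + al)) (seq A len) <= 1 + 5 * Y / INR a.
Proof.
  intros HY Ha HA Hal.
  assert (Ha0 : 0 < INR a) by (apply lt_0_INR; lia).
  apply rsum_indicator_spread.
  - apply Rdiv_le_0_compat; lra.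
  - intros n; apply near_01.
  - intros m n Hmn Hm Hn; unfold near in Hm, Hn.
    destruct Rle_dec as [Bm|] in Hm; [|lra]; destruct Rle_dec as [Bn|] in Hn; [|lra].
    apply Rabs_le_between in Bm, Bn.
    assert (Hm0 : 0 < INR m) by (apply lt_0_INR; lia).
    assert (Hn0 : 0 < INR n) by (apply lt_0_INR; lia).
    apply Rle_div_r; [exact Ha0|].
    apply Rmult_le_reg_r with (INR m + al + (INR n + al)); nra.
Qed.

Lemma rsum_slope_weight_le Y P al A len : 0 <= Y -> (1 <= A)%nat -> 0 <= al ->
  let H := rsum (fun d => / INR d) (seq 1 P) in
  rsum (fun n => slope_weight Y P (INR n + al)) (seq A len) <= H * (INR P + 5 * Y * H).
Proof.
  intros HY HA Hal H; unfold slope_weight.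
  rewrite rsum_switch.
  apply Rle_trans with (rsum (fun q => (INR P + 5 * Y * H) * / INR q) (seq 1 P)).
  - apply rsum_le; intros q Hq; apply in_seq in Hq.
    rewrite rsum_scal, Rmult_comm, rsum_switch.
    apply Rmult_le_compat_r; [left; apply Rinv_0_lt_compat, lt_0_INR; lia|].
    apply Rle_trans with (rsum (fun a => 1 + 5 * Y * / INR a) (seq 1 P)).
    + apply rsum_le; intros a Ha; apply in_seq in Ha; apply rsum_near_le; auto; lia.
    + rewrite rsum_plus, rsum_const, rsum_scal, length_seq; unfold H; lra.
  - rewrite rsum_scal; unfold H; lra.
Qed.

(** Dirichlet approximation of the slope [Y^3 / v^2] with denominators up to [v / Y]. The hypothesis
    [Y <= v] allows at least one denominator, and [v^2 <= Y^3] makes the slope at least 1, which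
    forces [a >= 1]. *)
Lemma psi_hyperbola_block (Y v : R) (P : nat) :
  1 <= Y -> 2 * Y <= INR P -> Y <= v -> v ^ 2 <= Y ^ 3 ->
  exists q : nat, (0 < q)%nat /\ INR q <= Y /\
    (forall b, Rabs (rsum (fun t => psi (Y ^ 3 / (v + INR t) - b)) (seq 0 q)) <= 5) /\
    (forall t, (t < q)%nat -> / INR q <= slope_weight Y P (v + INR t)).
Proof.
  intros HY HP Hv Hv2.
  set (N := Z.to_nat (Int_part (v / Y))).
  assert (HvY : 1 <= v / Y) by (apply Rle_div_r; lra).
  destruct (base_Int_part (v / Y)) as [I1 I2].
  assert (HI : (1 <= Int_part (v / Y))%Z).
  { assert (0 < Int_part (v / Y))%Z by (apply lt_IZR; lra). lia. }
  assert (HN : INR N = IZR (Int_part (v / Y)))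
    by (unfold N; rewrite INR_IZR_INZ, Z2Nat.id by lia; reflexivity).
  destruct (dirichlet_approximation (Y ^ 3 / v ^ 2) N ltac:(unfold N; lia))
    as (a & q' & Hq & Haq & Happ).
  assert (Hv2p : 0 < v ^ 2) by (apply pow_lt; lra).
  set (q := Z.to_nat q').
  assert (Eq : Z.of_nat q = q') by (unfold q; lia).
  assert (Eq' : IZR q' = INR q) by (rewrite INR_IZR_INZ, Eq; reflexivity).
  assert (Hq1 : 1 <= INR q) by (rewrite <- Eq'; apply IZR_le; lia).
  assert (HqN : INR q <= INR N) by (apply le_INR; lia).
  assert (HqY : INR q * Y <= v).
  { apply Rle_div_r; lra. }
  rewrite Eq' in Happ.
  assert (Hth : 1 <= Y ^ 3 / v ^ 2) by (apply Rle_div_r; lra).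
  (* If [a <= 0], the approximation error would be at least 1, against the bound [1 / (N + 1)]. *)
  assert (Ha1 : (1 <= a)%Z).
  { destruct (Z_lt_le_dec 0 a) as [|Hc]; [lia|exfalso].
    apply IZR_le in Hc.
    assert (1 <= Y ^ 3 / v ^ 2 * INR q - IZR a) by nra.
    rewrite Rabs_pos_eq in Happ by lra. nra. }
  assert (Hdist : Rabs (INR q * Y ^ 3 - IZR a * v ^ 2) <= Y * v).
  { replace (INR q * Y ^ 3 - IZR a * v ^ 2)
      with ((Y ^ 3 / v ^ 2 * INR q - IZR a) * v ^ 2) by (field; lra).
    rewrite Rabs_mult, (Rabs_pos_eq (v ^ 2)) by lra.
    set (E := Rabs _) in *.
    assert (HE : 0 <= E) by apply Rabs_pos.
    assert (E * (v / Y) <= 1) by nra.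
    replace (E * v ^ 2) with ((E * (v / Y)) * (Y * v)) by (field; lra).
    rewrite <- (Rmult_1_l (Y * v)) at 2.
    apply Rmult_le_compat_r; [apply Rmult_le_pos; lra|assumption]. }
  set (a' := Z.to_nat a).
  assert (Ea : IZR a = INR a') by (unfold a'; rewrite INR_IZR_INZ, Z2Nat.id by lia; reflexivity).
  (* Indeed [(q Y)^2 <= v^2 <= Y^3], so even [q^2 <= Y]. *)
  assert (HqYY : INR q <= Y).
  { assert ((INR q * Y) ^ 2 <= Y ^ 3) by (eapply Rle_trans; [apply pow_incr|exact Hv2]; nra).
    assert (INR q ^ 2 <= Y).
    { apply Rmult_le_reg_r with (Y ^ 2); [apply pow_lt; lra|].
      replace (INR q ^ 2 * Y ^ 2) with ((INR q * Y) ^ 2) by ring.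
      replace (Y * Y ^ 2) with (Y ^ 3) by ring. assumption. }
    nra. }
  assert (Hau : INR a' * v ^ 2 <= INR q * Y ^ 3 + Y * v)
    by (rewrite <- Ea; apply Rabs_le_between in Hdist; lra).
  (* Multiplying the bound on [a v^2] by [q] and using [q Y <= v] gives
     [a q v^2 <= Y v^2 + v^2 <= 2 Y v^2]. This keeps [a t <= 2 Y] along the block. *)
  assert (Haq2 : INR a' * INR q <= 2 * Y).
  { apply Rmult_le_reg_r with (v ^ 2); [exact Hv2p|].
    apply Rle_trans with (INR q * (INR q * Y ^ 3 + Y * v)).
    - replace (INR a' * INR q * v ^ 2) with (INR q * (INR a' * v ^ 2)) by ring.
      apply Rmult_le_compat_l; lra.
    - assert ((INR q * Y) ^ 2 <= v ^ 2) by (apply pow_incr; nra).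
      replace (INR q * (INR q * Y ^ 3 + Y * v)) with ((INR q * Y) ^ 2 * Y + (INR q * Y) * v) by ring.
      assert ((INR q * Y) * v <= v ^ 2) by nra.
      nra. }
  assert (Ha'1 : (1 <= a')%nat) by (unfold a'; lia).
  assert (Ha'R : 1 <= INR a') by (apply (le_INR 1); exact Ha'1).
  exists q; split; [lia|split; [exact HqYY|split]].
  - intros b.
    (* The linearization error is [2 / q], so [e = 2] would do; [9 / 4] rounds the bound to 5. *)
    replace 5 with (1 / 2 + 2 * (9 / 4)) by lra.
    apply psi_near_progression with (a := a) (c := Y ^ 3 / v - b);
      [lia|rewrite Eq; exact Haq|].
    intros t Ht.
    eapply Rle_trans; [apply hyperbola_linearization; auto; lra|].
    apply Rmult_le_compat_r; [left; apply Rinv_0_lt_compat|]; lra.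
  - intros t Ht.
    assert (Ht0 : 0 <= INR t) by apply pos_INR.
    assert (Htq : INR t <= INR q) by (apply le_INR; lia).
    apply slope_weight_ge with a'.
    + split; [exact Ha'1|apply INR_le; nra].
    + split; [lia|apply INR_le; lra].
    (* Moving from [v] to [v + t] changes the defect by at most [4 Y (v + t)]; with the initial
       [Y v] this explains the 5 in [near]. *)
    + unfold near; destruct Rle_dec as [|B]; [reflexivity|exfalso; apply B].
      replace (INR q * Y ^ 3 - INR a' * (v + INR t) ^ 2)
        with ((INR q * Y ^ 3 - IZR a * v ^ 2) + - (INR a' * INR t * (2 * v + INR t)))
        by (rewrite Ea; ring).
      eapply Rle_trans; [apply Rabs_triang|].
      rewrite Rabs_Ropp, (Rabs_pos_eq (INR a' * INR t * (2 * v + INR t))).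
      2:{ apply Rmult_le_pos; [apply Rmult_le_pos|]; lra. }
      assert (INR a' * INR t <= 2 * Y) by nra.
      assert (INR a' * INR t * (2 * v + INR t) <= 2 * Y * (2 * (v + INR t))).
      { apply Rmult_le_compat; try lra. apply Rmult_le_pos; lra. }
      nra.
Qed.

(* Greedy covering by blocks; the last, incomplete one has length at most [Y]. *)
Lemma psi_hyperbola_covering (Y al b : R) (P : nat) :
  1 <= Y -> 2 * Y <= INR P -> forall len A,
  (forall n, (A <= n < A + len)%nat -> Y <= INR n + al /\ (INR n + al) ^ 2 <= Y ^ 3) ->
  Rabs (rsum (fun n => psi (Y ^ 3 / (INR n + al) - b)) (seq A len))
    <= 5 * rsum (fun n => slope_weight Y P (INR n + al)) (seq A len) + Y.
Proof.
  intros HY HP len; induction len as [len IH] using (well_founded_induction lt_wf).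
  intros A HA.
  destruct (Nat.eq_dec len 0) as [->|Hlen]; [unfold rsum; simpl; rewrite Rabs_R0; lra|].
  destruct (HA A ltac:(lia)) as [HA1 HA2].
  destruct (psi_hyperbola_block Y (INR A + al) P HY HP HA1 HA2) as (q & Hq & HqY & Hb & Hw).
  assert (Hq0 : 0 < INR q) by (apply lt_0_INR; exact Hq).
  destruct (le_lt_dec q len) as [L|L].
  - replace len with (q + (len - q))%nat by lia.
    rewrite seq_app, !rsum_app.
    specialize (IH (len - q)%nat ltac:(lia) (A + q)%nat ltac:(intros n Hn; apply HA; lia)).
    eapply Rle_trans; [apply Rabs_triang|].
    assert (B1 : Rabs (rsum (fun n => psi (Y ^ 3 / (INR n + al) - b)) (seq A q)) <= 5).
    { rewrite rsum_seq_shift.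
      erewrite rsum_ext; [apply (Hb b)|].
      intros t _; simpl; rewrite plus_INR; do 3 f_equal; ring. }
    (* The [q] integers of a complete block carry charge at least [1 / q] each, which pays for the
       block. *)
    assert (B2 : 1 <= rsum (fun n => slope_weight Y P (INR n + al)) (seq A q)).
    { rewrite rsum_seq_shift.
      apply Rle_trans with (rsum (fun _ => / INR q) (seq 0 q)).
      - rewrite rsum_const, length_seq, Rinv_r; lra.
      - apply rsum_le; intros t Ht; apply in_seq in Ht.
        replace (INR (A + t) + al) with (INR A + al + INR t) by (rewrite plus_INR; ring).
        apply Hw; lia. }
    lra.
  - eapply Rle_trans; [apply rsum_abs|].
    apply Rle_trans with (rsum (fun _ => 1 / 2) (seq A len)).
    + apply rsum_le; intros; apply psi_bound.
    + rewrite rsum_const, length_seq.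
      assert (INR len <= INR q) by (apply le_INR; lia).
      assert (0 <= rsum (fun n => slope_weight Y P (INR n + al)) (seq A len)).
      { apply rsum_nonneg; intros n Hn; apply in_seq in Hn.
        specialize (Hw (n - A)%nat ltac:(lia)).
        replace (INR A + al + INR (n - A)) with (INR n + al) in Hw
          by (rewrite minus_INR by lia; ring).
        assert (0 < / INR q) by (apply Rinv_0_lt_compat; exact Hq0). lra. }
      lra.
Qed.

(** * Logarithmic factors *)

Lemma Rpower_pos x s : 0 < Rpower x s.
Proof. apply exp_pos. Qed.

Lemma Rpower_mono x s t : 1 <= x -> s <= t -> Rpower x s <= Rpower x t.
Proof.
  intros Hx Hst; unfold Rpower.
  assert (0 <= ln x) by (rewrite <- ln_1; apply ln_le; lra).
  destruct (Rle_lt_or_eq_dec (s * ln x) (t * ln x)) as [L|E]; [nra| |].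
  - left; apply exp_increasing; exact L.
  - rewrite E; lra.
Qed.

Lemma Rpower_ge_1 x s : 1 <= x -> 0 <= s -> 1 <= Rpower x s.
Proof.
  intros Hx Hs; rewrite <- (Rpower_O x) by lra; apply Rpower_mono; assumption.
Qed.

(* From [ln z <= z - 1] at [z = (x - 1) / x]. *)
Lemma Rpower_telescope (x s : R) : 1 < x -> 0 < s ->
  s * Rpower x (-1 - s) <= Rpower (x - 1) (- s) - Rpower x (- s).
Proof.
  intros Hx Hs.
  assert (Hz : 0 < (x - 1) / x) by (apply Rdiv_lt_0_compat; lra).
  assert (E1 : Rpower (x - 1) (- s) = Rpower x (- s) * Rpower ((x - 1) / x) (- s)).
  { rewrite Rpower_mult_distr by lra; f_equal; field; lra. }
  assert (E2 : Rpower x (-1 - s) = Rpower x (- s) * / x).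
  { replace (-1 - s) with (- s + - (1)) by ring.
    rewrite Rpower_plus, (Rpower_Ropp x 1), Rpower_1 by lra; reflexivity. }
  assert (Hln : ln ((x - 1) / x) <= - / x).
  { rewrite <- (ln_exp (- / x)); apply ln_le; [exact Hz|].
    pose proof (exp_ineq1_le (- / x)).
    replace ((x - 1) / x) with (1 + - / x) by (field; lra). lra. }
  assert (B : 1 + s * / x <= Rpower ((x - 1) / x) (- s)).
  { unfold Rpower.
    pose proof (exp_ineq1_le (- s * ln ((x - 1) / x))). nra. }
  rewrite E1, E2; pose proof (Rpower_pos x (- s)); nra.
Qed.

Lemma rsum_zeta_le (s : R) (P : nat) : 0 < s ->
  rsum (fun d => Rpower (INR d) (-1 - s)) (seq 1 P) <= 1 + / s.
Proof.
  intros Hs.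
  assert (Hi : 0 < / s) by (apply Rinv_0_lt_compat; exact Hs).
  destruct P as [|P]; [unfold rsum; simpl; lra|].
  (* The induction needs the telescoped remainder, which is dropped only at the end. *)
  enough (K : rsum (fun d => Rpower (INR d) (-1 - s)) (seq 1 (S P))
              <= 1 + / s * (1 - Rpower (INR (S P)) (- s))).
  { pose proof (Rpower_pos (INR (S P)) (- s)); nra. }
  induction P as [|P IH].
  - unfold rsum; simpl; unfold Rpower; rewrite ln_1, !Rmult_0_r, exp_0; lra.
  - rewrite rsum_seq_S.
    replace (1 + S P)%nat with (S (S P)) by lia.
    assert (T := Rpower_telescope (INR (S (S P))) s).
    replace (INR (S (S P)) - 1) with (INR (S P)) in T by (rewrite (S_INR (S P)); ring).
    assert (H2 : 1 < INR (S (S P))) by (apply (lt_INR 1); lia).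
    specialize (T H2 Hs).
    assert (Rpower (INR (S (S P))) (-1 - s)
            <= / s * (Rpower (INR (S P)) (- s) - Rpower (INR (S (S P))) (- s))).
    { apply Rmult_le_reg_l with s; [exact Hs|].
      rewrite <- Rmult_assoc, Rinv_r by lra; lra. }
    lra.
Qed.

(** Writing [1 / d = d^s d^(-1-s)] and bounding [d^s] by [P^s] trades the logarithm for a small
    power. *)
Lemma harmonic_le_Rpower (s : R) (P : nat) : 0 < s ->
  rsum (fun d => / INR d) (seq 1 P) <= (1 + / s) * Rpower (INR P) s.
Proof.
  intros Hs.
  apply Rle_trans with (rsum (fun d => Rpower (INR P) s * Rpower (INR d) (-1 - s)) (seq 1 P)).
  - apply rsum_le; intros d Hd; apply in_seq in Hd.
    assert (Hd0 : 0 < INR d) by (apply lt_0_INR; lia).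
    replace (/ INR d) with (Rpower (INR d) s * Rpower (INR d) (-1 - s)).
    + apply Rmult_le_compat_r; [left; apply Rpower_pos|].
      apply Rle_Rpower_l; [lra|split; [exact Hd0|apply le_INR; lia]].
    + rewrite <- Rpower_plus; replace (s + (-1 - s)) with (- (1)) by ring.
      rewrite Rpower_Ropp, Rpower_1 by exact Hd0; reflexivity.
  - rewrite rsum_scal, Rmult_comm; apply Rmult_le_compat_r; [left; apply Rpower_pos|].
    apply rsum_zeta_le, Hs.
Qed.

Lemma cube_Rpower_third y : 0 < y -> Rpower y (1 / 3) ^ 3 = y.
Proof.
  intros Hy; rewrite <- Rpower_pow by apply Rpower_pos.
  rewrite Rpower_mult; replace (1 / 3 * INR 3) with 1 by (simpl; lra).
  apply Rpower_1, Hy.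
Qed.

(** Terms with [n <= Y] are bounded trivially, the others by the block covering. The shifts [al] and
    [b] are kept free, and [K] is uniform in them, because both 0 and [1 / d] occur later. *)
Lemma psi_hyperbola_sum (s : R) : 0 < s -> exists K : R, 0 <= K /\
  forall (y al b : R) (Z : nat), 1 <= y -> 0 <= al ->
  (forall n, (1 <= n <= Z)%nat -> (INR n + al) ^ 2 <= y) ->
  Rabs (rsum (fun n => psi (y / (INR n + al) - b)) (seq 1 Z)) <= K * Rpower y (1 / 3 + s).
Proof.
  intros Hs.
  (* The 4 comes from [P <= 4 Y] for the [P] chosen below. *)
  set (c := (1 + / s) * Rpower 4 s).
  assert (Hi : 0 < / s) by (apply Rinv_0_lt_compat; exact Hs).
  assert (Hc : 0 <= c) by (apply Rmult_le_pos; [lra|left; apply Rpower_pos]).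
  exists (47 * c ^ 2); split; [pose proof (pow2_ge_0 c); lra|].
  intros y al b Z Hy Hal HZ.
  set (Y := Rpower y (1 / 3)).
  assert (HY : 1 <= Y) by (apply Rpower_ge_1; lra).
  assert (HY3 : Y ^ 3 = y) by (apply cube_Rpower_third; lra).
  destruct (base_Int_part Y) as [I1 I2].
  (* The first integer above [Y]: it gives [n + al >= Y] for all [n >= A], and [P = 2 A] lies
     between [2 Y] and [4 Y]. *)
  set (A := S (Z.to_nat (Int_part Y))).
  assert (HI : (0 < Int_part Y)%Z) by (apply lt_IZR; lra).
  assert (EA : INR A = IZR (Int_part Y) + 1)
    by (unfold A; rewrite S_INR, INR_IZR_INZ, Z2Nat.id by lia; reflexivity).
  set (P := (2 * A)%nat).
  assert (EP : INR P = 2 * INR A) by (unfold P; rewrite mult_INR; simpl; ring).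
  set (H := rsum (fun d => / INR d) (seq 1 P)).
  assert (HH1 : 1 <= H).
  { replace 1 with (/ INR 1) by (simpl; lra).
    apply (rsum_ge_term (fun d => / INR d)); [|apply in_seq; unfold P, A; lia].
    intros z Hz; apply in_seq in Hz; left; apply Rinv_0_lt_compat, lt_0_INR; lia. }
  assert (HH2 : H <= c * Rpower Y s).
  { eapply Rle_trans; [apply harmonic_le_Rpower, Hs|].
    unfold c; rewrite Rmult_assoc; apply Rmult_le_compat_l; [lra|].
    rewrite Rpower_mult_distr by lra.
    apply Rle_Rpower_l; lra. }
  assert (Hfar : forall A' len, (A <= A')%nat -> (A' + len <= S Z)%nat ->
    Rabs (rsum (fun n => psi (y / (INR n + al) - b)) (seq A' len))
      <= 5 * (H * (INR P + 5 * Y * H)) + Y).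
  { intros A' len HA' Hlen.
    pose proof (psi_hyperbola_covering Y al b P HY ltac:(lra) len A') as Cov.
    rewrite HY3 in Cov.
    eapply Rle_trans; [apply Cov|].
    - intros n Hn; split; [|apply HZ; unfold A in HA'; lia].
      assert (INR A <= INR n) by (apply le_INR; lia). lra.
    - pose proof (rsum_slope_weight_le Y P al A' len) as W; cbv zeta in W; fold H in W.
      specialize (W ltac:(lra) ltac:(unfold A in HA'; lia) Hal). lra. }
  assert (Hnear : forall len, (len < A)%nat ->
    Rabs (rsum (fun n => psi (y / (INR n + al) - b)) (seq 1 len)) <= Y).
  { intros len Hlen.
    eapply Rle_trans; [apply rsum_abs|].
    apply Rle_trans with (rsum (fun _ => 1 / 2) (seq 1 len)).
    - apply rsum_le; intros; apply psi_bound.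
    - rewrite rsum_const, length_seq.
      assert (INR (S len) <= INR A) by (apply le_INR; lia).
      rewrite S_INR in *; lra. }
  assert (B : Rabs (rsum (fun n => psi (y / (INR n + al) - b)) (seq 1 Z)) <= 47 * (Y * H ^ 2)).
  { apply Rle_trans with (5 * (H * (INR P + 5 * Y * H)) + 2 * Y).
    - destruct (le_lt_dec A Z) as [L|L].
      + replace Z with ((A - 1) + (Z - (A - 1)))%nat by lia.
        rewrite seq_app, rsum_app.
        eapply Rle_trans; [apply Rabs_triang|].
        specialize (Hnear (A - 1)%nat ltac:(unfold A; lia)).
        specialize (Hfar (1 + (A - 1))%nat (Z - (A - 1))%nat ltac:(lia) ltac:(lia)).
        lra.
      + specialize (Hnear Z L).
        assert (0 <= H * (INR P + 5 * Y * H)) by (repeat apply Rmult_le_pos; nra).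
        lra.
    - assert (INR P <= 4 * Y) by lra.
      assert (HYH : Y <= Y * H) by (rewrite <- (Rmult_1_r Y) at 1; apply Rmult_le_compat_l; lra).
      assert (H * (INR P + 5 * Y * H) <= H * (9 * (Y * H)))
        by (apply Rmult_le_compat_l; lra).
      assert (Y * H <= Y * H * H)
        by (rewrite <- (Rmult_1_r (Y * H)) at 1; apply Rmult_le_compat_l; lra).
      replace (Y * H ^ 2) with (Y * H * H) by ring.
      lra. }
  eapply Rle_trans; [exact B|].
  rewrite Rmult_assoc; apply Rmult_le_compat_l; [lra|].
  apply Rle_trans with (Y * (c * Rpower Y s) ^ 2).
  - apply Rmult_le_compat_l; [lra|]. apply pow_incr; lra.
  - replace (Y * (c * Rpower Y s) ^ 2) with (c ^ 2 * (Y * (Rpower Y s * Rpower Y s))) by ring.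
    apply Rmult_le_compat_l; [apply pow2_ge_0|].
    (* The exponent obtained is [1 / 3 + 2 s / 3], below [1 / 3 + s]. *)
    unfold Y; rewrite !Rpower_mult, <- !Rpower_plus.
    apply Rpower_mono; lra.
Qed.

(** * Counting the quotients divisible by d *)

Definition indic (b : bool) : R := if b then 1 else 0.

Definition dvd (d m : nat) : R := indic (m mod d =? 0)%nat.

Lemma indic_bounds b : 0 <= indic b <= 1.
Proof. destruct b; simpl; lra. Qed.

Lemma rsum_indic_eq (F : nat -> R) (j A len : nat) : (A <= j < A + len)%nat ->
  rsum (fun k => indic (k =? j)%nat * F k) (seq A len) = F j.
Proof.
  intros Hj.
  assert (Z0 : forall B n, (j < B \/ B + n <= j)%nat ->
    rsum (fun k => indic (k =? j)%nat * F k) (seq B n) = 0).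
  { intros B n HB; rewrite (rsum_ext _ (fun _ => 0)); [rewrite rsum_const; ring|].
    intros k Hk; apply in_seq in Hk.
    rewrite (proj2 (Nat.eqb_neq k j)) by lia; simpl; ring. }
  replace len with ((j - A) + (1 + (len - (j - A) - 1)))%nat by lia.
  rewrite !seq_app, !rsum_app.
  rewrite (Z0 A), (Z0 (A + (j - A) + 1)%nat) by lia.
  replace (A + (j - A))%nat with j by lia.
  unfold rsum; simpl; rewrite Nat.eqb_refl; simpl; ring.
Qed.

Lemma rsum_indic_leb (U Z len : nat) : (Z <= U <= Z + len)%nat ->
  rsum (fun n => indic (n <=? U)%nat) (seq (S Z) len) = INR U - INR Z.
Proof.
  intros HU.
  replace len with ((U - Z) + (len - (U - Z)))%nat by lia.
  rewrite seq_app, rsum_app.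
  rewrite (rsum_ext _ (fun _ => 1) (seq (S Z) (U - Z))).
  - rewrite (rsum_ext _ (fun _ => 0) (seq (S Z + (U - Z)) _)).
    + rewrite !rsum_const, length_seq, minus_INR by lia; ring.
    + intros n Hn; apply in_seq in Hn; rewrite (proj2 (Nat.leb_gt n U)) by lia; reflexivity.
  - intros n Hn; apply in_seq in Hn; rewrite (proj2 (Nat.leb_le n U)) by lia; reflexivity.
Qed.

Lemma rsum_telescope (G : nat -> R) A len :
  rsum (fun k => G k - G (S k)) (seq A len) = G A - G (A + len)%nat.
Proof.
  induction len as [|len IH]; [rewrite Nat.add_0_r; unfold rsum; simpl; ring|].
  rewrite rsum_seq_S, IH, Nat.add_succ_r; ring.
Qed.

(** Divisibility as a sum over the possible cofactors [k], so that summations can be interchanged;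
    [Z] is any bound for the cofactor. *)
Lemma dvd_as_count (d m Z : nat) : (1 <= d)%nat -> (1 <= m)%nat -> (m / d <= Z)%nat ->
  dvd d m = rsum (fun k => indic (m =? k * d)%nat) (seq 1 Z).
Proof.
  intros Hd Hm HZ; unfold dvd.
  pose proof (Nat.div_mod m d ltac:(lia)) as E.
  pose proof (Nat.mod_upper_bound m d ltac:(lia)) as U.
  destruct (Nat.eqb_spec (m mod d) 0) as [E0|E0].
  - assert (1 <= m / d)%nat by (destruct (m / d)%nat; lia).
    rewrite (rsum_ext _ (fun k => indic (k =? m / d)%nat * 1)).
    + rewrite rsum_indic_eq by lia; reflexivity.
    + intros k _; rewrite Rmult_1_r; f_equal.
      apply Bool.eq_true_iff_eq; rewrite !Nat.eqb_eq; split; intros; nia.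
  - rewrite (rsum_ext _ (fun _ => 0)); [rewrite rsum_const; simpl; ring|].
    intros k _; destruct (Nat.eqb_spec m (k * d)) as [Ek|]; [|reflexivity].
    exfalso; apply E0; rewrite Ek; apply Nat.Div0.mod_mul.
Qed.

Lemma rsum_dvd (F : nat -> R) (d M : nat) : (1 <= d)%nat ->
  rsum (fun m => dvd d m * F m) (seq 1 M) = rsum (fun k => F (k * d)%nat) (seq 1 (M / d)).
Proof.
  intros Hd.
  rewrite (rsum_ext _ (fun m => rsum (fun k => indic (m =? k * d)%nat * F m) (seq 1 (M / d)))).
  - rewrite rsum_switch; apply rsum_ext; intros k Hk; apply in_seq in Hk.
    apply rsum_indic_eq.
    pose proof (Nat.Div0.mul_div_le M d). nia.
  - intros m Hm; apply in_seq in Hm.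
    rewrite (dvd_as_count d m (M / d)) by (try lia; apply Nat.Div0.div_le_mono; lia).
    rewrite Rmult_comm, <- rsum_scal; apply rsum_ext; intros; ring.
Qed.

Lemma dvd_as_floor_diff (d m : nat) : (1 <= d)%nat -> (1 <= m)%nat ->
  dvd d m = INR (m / d) - INR ((m - 1) / d).
Proof.
  intros Hd Hm; unfold dvd.
  pose proof (Nat.div_mod m d ltac:(lia)) as E.
  pose proof (Nat.mod_upper_bound m d ltac:(lia)) as U.
  destruct (Nat.eqb_spec (m mod d) 0) as [E0|E0].
  - assert (1 <= m / d)%nat by (destruct (m / d)%nat; lia).
    rewrite <- (Nat.div_unique (m - 1) d (m / d - 1) (d - 1)) by nia.
    rewrite minus_INR by lia; simpl; ring.
  - rewrite <- (Nat.div_unique (m - 1) d (m / d) (m mod d - 1)) by nia.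
    simpl; ring.
Qed.

Lemma INR_div_psi (a b : nat) : (1 <= b)%nat ->
  INR (a / b) = INR a / INR b - psi (INR a / INR b) - 1 / 2.
Proof.
  intros Hb; unfold psi, frac_part.
  assert (Hb0 : 0 < INR b) by (apply lt_0_INR; lia).
  rewrite (Int_part_eq _ (Z.of_nat (a / b))); [rewrite <- INR_IZR_INZ; ring|].
  rewrite <- INR_IZR_INZ; split.
  - apply Rle_div_r; [exact Hb0|]. rewrite <- mult_INR; apply le_INR.
    rewrite Nat.mul_comm; apply Nat.Div0.mul_div_le.
  - apply Rlt_div_l; [exact Hb0|]. rewrite <- S_INR, <- mult_INR; apply lt_INR.
    rewrite Nat.mul_comm; apply Nat.mul_succ_div_gt; lia.
Qed.

Lemma le_div_iff (n m N : nat) : (1 <= m)%nat -> (n <= N / m <-> n * m <= N)%nat.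
Proof.
  intros Hm; rewrite (Nat.mul_comm n m); split; intros H.
  - pose proof (Nat.Div0.mul_div_le N m); nia.
  - apply Nat.div_le_lower_bound; lia.
Qed.

(** The integral part of [N / n] equals [m] exactly for [N / (m + 1) < n <= N / m]. *)
Lemma indic_div_eq (N n m : nat) : (1 <= n)%nat -> (1 <= m)%nat ->
  indic (N / n =? m)%nat = indic (n <=? N / m)%nat - indic (n <=? N / (m + 1))%nat.
Proof.
  intros Hn Hm.
  pose proof (le_div_iff n m N Hm) as A1. pose proof (le_div_iff m n N Hn) as A2.
  pose proof (le_div_iff n (m + 1) N ltac:(lia)) as B1.
  pose proof (le_div_iff (m + 1) n N Hn) as B2.
  rewrite (Nat.mul_comm m n) in A2. rewrite (Nat.mul_comm (m + 1) n) in B2.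
  destruct (Nat.eqb_spec (N / n) m), (Nat.leb_spec n (N / m)),
    (Nat.leb_spec n (N / (m + 1))); simpl; try lra; exfalso; lia.
Qed.

(* [quot_count N d] is T_d of the header for x = N; [quot_density M d] is the density
   truncated to m <= M. *)
Definition quot_count (N d : nat) : R := rsum (fun n => dvd d (N / n)) (seq 1 N).

Definition quot_density (M d : nat) : R :=
  rsum (fun m => dvd d m * / (INR m * (INR m + 1))) (seq 1 M).

Definition pronic_inv (d k : nat) : R := / (INR (k * d) * (INR (k * d) + 1)).

Lemma quot_density_pronic M d : (1 <= d)%nat ->
  quot_density M d = rsum (pronic_inv d) (seq 1 (M / d)).
Proof. intros Hd; unfold quot_density; rewrite rsum_dvd by exact Hd; reflexivity. Qed.

(** Comparison with the telescoping differences of [1 / (k - 1 / 2)], which equal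
    [1 / (k^2 - 1 / 4)]. The shift by one half keeps the bound finite at [A = 1]. *)
Lemma rsum_pronic_upper (d A len : nat) : (1 <= d)%nat -> (1 <= A)%nat ->
  rsum (pronic_inv d) (seq A len) <= / (INR d ^ 2 * (INR A - 1 / 2)).
Proof.
  intros Hd HA.
  assert (Hd1 : 1 <= INR d) by (apply (le_INR 1); exact Hd).
  set (G := fun k => / INR d ^ 2 * / (INR k - 1 / 2)).
  apply Rle_trans with (rsum (fun k => G k - G (S k)) (seq A len)).
  - apply rsum_le; intros k Hk; apply in_seq in Hk; unfold G, pronic_inv.
    assert (Hk1 : 1 <= INR k) by (apply (le_INR 1); lia).
    rewrite S_INR, mult_INR.
    replace (/ INR d ^ 2 * / (INR k - 1 / 2) - / INR d ^ 2 * / (INR k + 1 - 1 / 2))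
      with (/ (INR d ^ 2 * (INR k ^ 2 - 1 / 4))) by (field; repeat split; nra).
    apply Rinv_le_contravar.
    + apply Rmult_lt_0_compat; [apply pow_lt; lra|nra].
    + replace (INR k * INR d * (INR k * INR d + 1))
        with (INR d ^ 2 * INR k ^ 2 + INR k * INR d) by ring.
      pose proof (pow2_ge_0 (INR d)). nra.
  - rewrite rsum_telescope; unfold G.
    assert (1 <= INR A) by (apply (le_INR 1); lia).
    assert (1 <= INR (A + len)) by (apply (le_INR 1); lia).
    rewrite Rinv_mult.
    assert (0 <= / INR d ^ 2 * / (INR (A + len) - 1 / 2)).
    { apply Rmult_le_pos; left; apply Rinv_0_lt_compat; [apply pow_lt|]; lra. }
    lra.
Qed.

(** Since [d >= 1], one has [k d + 1 <= d (k + 1)], and [1 / (k (k + 1))] telescopes. *)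
Lemma rsum_pronic_lower (d A len : nat) : (1 <= d)%nat -> (1 <= A)%nat ->
  / INR d ^ 2 * (/ INR A - / INR (A + len)) <= rsum (pronic_inv d) (seq A len).
Proof.
  intros Hd HA.
  assert (Hd1 : 1 <= INR d) by (apply (le_INR 1); exact Hd).
  rewrite <- (rsum_telescope (fun k => / INR k)), <- rsum_scal.
  apply rsum_le; intros k Hk; apply in_seq in Hk; unfold pronic_inv.
  assert (Hk1 : 1 <= INR k) by (apply (le_INR 1); lia).
  rewrite S_INR, mult_INR.
  replace (/ INR d ^ 2 * (/ INR k - / (INR k + 1)))
    with (/ (INR d * INR k * (INR d * (INR k + 1)))) by (field; repeat split; lra).
  apply Rinv_le_contravar.
  - apply Rmult_lt_0_compat; nra.
  - rewrite (Rmult_comm (INR d) (INR k)); apply Rmult_le_compat_l; nra.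
Qed.

Lemma quot_density_bounds M d : (1 <= d)%nat -> 0 <= quot_density M d <= 2 / INR d ^ 2.
Proof.
  intros Hd; split.
  - apply rsum_nonneg; intros m Hm; apply in_seq in Hm.
    assert (0 < INR m) by (apply lt_0_INR; lia).
    apply Rmult_le_pos; [apply indic_bounds|left; apply Rinv_0_lt_compat; nra].
  - rewrite quot_density_pronic by exact Hd.
    eapply Rle_trans; [apply rsum_pronic_upper; auto|].
    assert (0 < INR d) by (apply lt_0_INR; lia).
    right; simpl; field; lra.
Qed.

(** * Comparison of the counts with their densities by the hyperbola method *)

Lemma quot_count_large N d : (N < d)%nat -> quot_count N d = 0.
Proof.
  intros Hd; unfold quot_count.
  rewrite (rsum_ext _ (fun _ => 0)); [rewrite rsum_const; ring|].
  intros n Hn; apply in_seq in Hn; unfold dvd.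
  assert (N / n <= N)%nat by (apply Nat.Div0.div_le_upper_bound; nia).
  assert (1 <= N / n)%nat by (apply Nat.div_le_lower_bound; lia).
  rewrite Nat.mod_small by lia.
  rewrite (proj2 (Nat.eqb_neq _ _)) by lia; reflexivity.
Qed.

(** For small [n], divisibility is the jump of the integral part of [m / d] at [m = N / n]. The
    zeros in [+ 0] and [- 0] fit the terms to the shape [y / (n + al) - b]. *)
Lemma quot_count_near (N d Z : nat) : (1 <= d)%nat -> (Z <= N)%nat ->
  rsum (fun n => dvd d (N / n)) (seq 1 Z)
  = INR Z / INR d
    + rsum (fun n => psi (INR N / INR d / (INR n + 0) - / INR d)) (seq 1 Z)
    - rsum (fun n => psi (INR N / INR d / (INR n + 0) - 0)) (seq 1 Z).
Proof.
  intros Hd HZ.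
  assert (Hd0 : 0 < INR d) by (apply lt_0_INR; lia).
  unfold Rdiv at 1; rewrite <- (length_seq Z 1) at 2.
  rewrite <- rsum_const, <- rsum_plus, <- rsum_minus.
  apply rsum_ext; intros n Hn; apply in_seq in Hn.
  assert (Hn0 : 0 < INR n) by (apply lt_0_INR; lia).
  rewrite dvd_as_floor_diff by (try apply Nat.div_le_lower_bound; lia).
  (* Writing the predecessor as a quotient by [n] merges the nested divisions; its argument is
     [N / (n d) - 1 / d], whence the shift [b = 1 / d]. *)
  replace (N / n - 1)%nat with ((N - n) / n)%nat.
  2:{ replace N with ((N - n) + 1 * n)%nat at 2 by lia.
      rewrite Nat.div_add by lia; lia. }
  rewrite !Nat.Div0.div_div.
  rewrite !INR_div_psi by nia.
  rewrite mult_INR, minus_INR by lia.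
  replace ((INR N - INR n) / (INR n * INR d)) with (INR N / INR d / (INR n + 0) - / INR d)
    by (field; lra).
  replace (INR N / (INR n * INR d)) with (INR N / INR d / (INR n + 0) - 0) by (field; lra).
  lra.
Qed.

(** For [n > Z] the quotients divisible by [d] are [k d] with [k <= Z], so one counts by [k]. For
    [k < Z] all the [n] with quotient [k d] exceed [Z]; only [k = Z] may be cut off, and it
    contributes at most 2. *)
Lemma quot_count_far (N d Z : nat) : (1 <= d <= N)%nat -> Z = Nat.sqrt (N / d) ->
  0 <= rsum (fun n => dvd d (N / n)) (seq (S Z) (N - Z))
       - rsum (fun k => INR (N / (k * d)) - INR (N / (k * d + 1))) (seq 1 (Z - 1)) <= 2.
Proof.
  intros Hd HZ.
  destruct (Nat.sqrt_spec' (N / d)) as [S1 S2]; rewrite <- HZ in S1, S2.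
  assert (Hy : (1 <= N / d)%nat) by (apply Nat.div_le_lower_bound; lia).
  assert (HZ1 : (1 <= Z)%nat) by (destruct Z; lia).
  assert (HZd : (Z * Z * d <= N)%nat) by (apply le_div_iff; lia).
  assert (HZN : (Z <= N)%nat) by nia.
  set (cnt := fun k => rsum (fun n => indic (N / n =? k * d)%nat) (seq (S Z) (N - Z))).
  assert (E : rsum (fun n => dvd d (N / n)) (seq (S Z) (N - Z)) = rsum cnt (seq 1 Z)).
  { unfold cnt; rewrite rsum_switch; apply rsum_ext; intros n Hn; apply in_seq in Hn.
    apply dvd_as_count; [lia|apply Nat.div_le_lower_bound; lia|].
    rewrite Nat.Div0.div_div, Nat.mul_comm, <- Nat.Div0.div_div.
    (* This follows from [N / d < (Z + 1)^2] and [n >= Z + 1]. *)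
    enough (N / d / n < S Z)%nat by lia.
    apply Nat.Div0.div_lt_upper_bound; nia. }
  assert (C : forall k, (1 <= k)%nat -> cnt k
      = rsum (fun n => indic (n <=? N / (k * d))%nat) (seq (S Z) (N - Z))
        - rsum (fun n => indic (n <=? N / (k * d + 1))%nat) (seq (S Z) (N - Z))).
  { intros k Hk; unfold cnt; rewrite <- rsum_minus; apply rsum_ext; intros n Hn.
    apply in_seq in Hn; apply indic_div_eq; nia. }
  assert (U : forall m, (1 <= m)%nat -> (N / m <= N)%nat)
    by (intros m Hm; apply Nat.Div0.div_le_upper_bound; nia).
  assert (C1 : forall k, (1 <= k <= Z - 1)%nat ->
    cnt k = INR (N / (k * d)) - INR (N / (k * d + 1))).
  { intros k Hk; rewrite C by lia.
    (* Since [k <= Z - 1] and [d >= 1], one has [Z (k d + 1) <= Z^2 d <= N]. *)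
    assert (Z <= N / (k * d + 1))%nat by (apply le_div_iff; nia).
    assert (N / (k * d + 1) <= N / (k * d))%nat by (apply Nat.div_le_compat_l; nia).
    pose proof (U (k * d)%nat ltac:(nia)).
    rewrite !rsum_indic_leb by lia; ring. }
  assert (C2 : 0 <= cnt Z <= 2).
  { split; [apply rsum_nonneg; intros; apply indic_bounds|].
    rewrite C by exact HZ1.
    assert (Z <= N / (Z * d))%nat by (apply le_div_iff; nia).
    pose proof (U (Z * d)%nat ltac:(nia)).
    rewrite rsum_indic_leb by lia.
    assert (0 <= rsum (fun n => indic (n <=? N / (Z * d + 1))%nat) (seq (S Z) (N - Z)))
      by (apply rsum_nonneg; intros; apply indic_bounds).
    (* From [N / d <= Z^2 + 2 Z]. *)
    assert (B : (N / (Z * d) <= Z + 2)%nat).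
    { rewrite Nat.mul_comm, <- Nat.Div0.div_div.
      apply Nat.Div0.div_le_upper_bound; nia. }
    apply le_INR in B; rewrite plus_INR in B; simpl in B; lra. }
  rewrite E; replace Z with (S (Z - 1)) at 1 3 by lia.
  rewrite rsum_seq_S; replace (1 + (Z - 1))%nat with Z by lia.
  rewrite (rsum_ext cnt (fun k => INR (N / (k * d)) - INR (N / (k * d + 1)))
             (seq 1 (Z - 1))) by (intros k Hk; apply in_seq in Hk; apply C1; lia).
  lra.
Qed.

(** The smooth parts differ by [N / (k d (k d + 1))], the density term, and [N / (k d + 1)] is
    [y / (k + 1 / d)], whence the shift [al = 1 / d]. *)
Lemma floor_diff_sum (N d Z : nat) : (1 <= d)%nat ->
  rsum (fun k => INR (N / (k * d)) - INR (N / (k * d + 1))) (seq 1 Z)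
  = INR N * rsum (pronic_inv d) (seq 1 Z)
    + rsum (fun k => psi (INR N / INR d / (INR k + / INR d) - 0)) (seq 1 Z)
    - rsum (fun k => psi (INR N / INR d / (INR k + 0) - 0)) (seq 1 Z).
Proof.
  intros Hd.
  assert (Hd0 : 0 < INR d) by (apply lt_0_INR; lia).
  rewrite <- rsum_scal, <- rsum_plus, <- rsum_minus.
  apply rsum_ext; intros k Hk; apply in_seq in Hk.
  assert (Hk0 : 0 < INR k) by (apply lt_0_INR; lia).
  assert (0 < INR k * INR d) by (apply Rmult_lt_0_compat; lra).
  rewrite !INR_div_psi by nia.
  unfold pronic_inv; rewrite plus_INR, mult_INR, INR_1.
  replace (INR N / INR d / (INR k + / INR d) - 0) with (INR N / (INR k * INR d + 1))
    by (field; repeat split; nra).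
  replace (INR N / INR d / (INR k + 0) - 0) with (INR N / (INR k * INR d)) by (field; lra).
  replace (INR N * / (INR k * INR d * (INR k * INR d + 1)))
    with (INR N / (INR k * INR d) - INR N / (INR k * INR d + 1)) by (field; lra).
  ring.
Qed.

(** The density over [k >= Z] is about [N / (d^2 Z)], that is [Z / d] because [N] is close to
    [d Z^2]; this matches the main term of the range [n <= Z]. Truncating at [M >= N] costs at most
    1. *)
Lemma density_tail (N d M Z : nat) : (1 <= d <= N)%nat -> (N <= M)%nat ->
  Z = Nat.sqrt (N / d) ->
  Rabs (INR N * rsum (pronic_inv d) (seq Z (M / d + 1 - Z)) - INR Z / INR d) <= 8.
Proof.
  intros Hd HM HZ.
  destruct (Nat.sqrt_spec' (N / d)) as [S1 S2]; rewrite <- HZ in S1, S2.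
  assert (Hy : (1 <= N / d)%nat) by (apply Nat.div_le_lower_bound; lia).
  assert (HZ1 : (1 <= Z)%nat) by (destruct Z; lia).
  assert (HZy : (Z <= N / d)%nat) by nia.
  assert (HyM : (N / d <= M / d)%nat) by (apply Nat.Div0.div_le_mono; exact HM).
  assert (Hd1 : 1 <= INR d) by (apply (le_INR 1); lia).
  assert (HZR : 1 <= INR Z) by (apply (le_INR 1); exact HZ1).
  pose proof (pos_INR N) as HN0.
  assert (L : INR Z * INR Z * INR d <= INR N).
  { rewrite <- !mult_INR; apply le_INR, le_div_iff; lia. }
  assert (Uy : INR N <= (INR Z + 1) * (INR Z + 1) * INR d).
  { rewrite <- S_INR, <- !mult_INR; apply le_INR.
    pose proof (Nat.mul_succ_div_gt N d ltac:(lia)). nia. }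
  pose proof (rsum_pronic_upper d Z (M / d + 1 - Z) ltac:(lia) HZ1) as U.
  pose proof (rsum_pronic_lower d Z (M / d + 1 - Z) ltac:(lia) HZ1) as W.
  replace (Z + (M / d + 1 - Z))%nat with (M / d + 1)%nat in W by lia.
  set (T := rsum (pronic_inv d) _) in *.
  apply (Rmult_le_compat_l (INR N)) in U; [|exact HN0].
  apply (Rmult_le_compat_l (INR N)) in W; [|exact HN0].
  assert (HK : INR N <= INR d * INR (M / d + 1)).
  { rewrite <- mult_INR; apply le_INR.
    pose proof (Nat.mul_succ_div_gt M d ltac:(lia)). nia. }
  assert (HK0 : 0 < INR (M / d + 1)) by (apply lt_0_INR; lia).
  assert (Hinv : / INR d <= 1) by (rewrite <- Rinv_1; apply Rinv_le_contravar; lra).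
  assert (Hinv0 : 0 < / INR d) by (apply Rinv_0_lt_compat; lra).
  assert (U2 : INR N * / (INR d ^ 2 * (INR Z - 1 / 2)) <= INR Z / INR d + 8).
  { apply Rle_trans with ((INR Z + 8) * / INR d); [|unfold Rdiv; lra].
    apply Rle_div_l; [apply Rmult_lt_0_compat; [apply pow_lt|]; lra|].
    replace ((INR Z + 8) * / INR d * (INR d ^ 2 * (INR Z - 1 / 2)))
      with ((INR Z + 8) * (INR Z - 1 / 2) * INR d) by (field; lra).
    eapply Rle_trans; [exact Uy|]. apply Rmult_le_compat_r; nra. }
  assert (W2 : INR Z / INR d - 1 <= INR N * (/ INR d ^ 2 * (/ INR Z - / INR (M / d + 1)))).
  { replace (INR N * (/ INR d ^ 2 * (/ INR Z - / INR (M / d + 1))))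
      with (INR N / (INR d ^ 2 * INR Z) - INR N / (INR d * INR (M / d + 1)) * / INR d)
      by (field; repeat split; lra).
    assert (B1 : INR Z / INR d <= INR N / (INR d ^ 2 * INR Z)).
    { apply -> Rle_div_r; [|apply Rmult_lt_0_compat; [apply pow_lt|]; lra].
      replace (INR Z / INR d * (INR d ^ 2 * INR Z)) with (INR Z * INR Z * INR d)
        by (field; lra). exact L. }
    assert (B2 : INR N / (INR d * INR (M / d + 1)) <= 1)
      by (apply Rle_div_l; nra).
    assert (B3 : 0 <= INR N / (INR d * INR (M / d + 1)))
      by (apply Rdiv_le_0_compat; nra).
    nra. }
  apply Rabs_le; lra.
Qed.

(** The main terms of both ranges cancel against the density split at [k = Z]. Four sums of [psi]
    remain, with bounded errors 2 from the last cofactor and 8 from the tail. *)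
Lemma quot_count_asymptotic (s : R) : 0 < s -> exists K : R, 0 <= K /\
  forall N d M : nat, (1 <= d <= N)%nat -> (N <= M)%nat ->
  Rabs (quot_count N d - INR N * quot_density M d) <= K * Rpower (INR N / INR d) (1 / 3 + s).
Proof.
  intros Hs; destruct (psi_hyperbola_sum s Hs) as (K & HK & Hpsi).
  exists (4 * K + 10); split; [lra|].
  intros N d M Hd HM.
  set (y := INR N / INR d).
  assert (Hd1 : 1 <= INR d) by (apply (le_INR 1); lia).
  assert (Hy : 1 <= y).
  { apply -> Rle_div_r; [rewrite Rmult_1_l; apply le_INR; lia|lra]. }
  remember (Nat.sqrt (N / d)) as Z eqn:HZ.
  assert (Hy1 : (1 <= N / d)%nat) by (apply Nat.div_le_lower_bound; lia).
  destruct (Nat.sqrt_spec' (N / d)) as [S1 S2]; rewrite <- HZ in S1, S2.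
  assert (HZ1 : (1 <= Z)%nat) by (destruct Z; lia).
  assert (HZd : (Z * Z * d <= N)%nat) by (apply le_div_iff; lia).
  assert (HZN : (Z <= N)%nat) by nia.
  assert (HZy : INR Z ^ 2 <= y).
  { apply -> Rle_div_r; [|lra]. simpl; rewrite Rmult_1_r, <- !mult_INR; apply le_INR; lia. }
  assert (H0 : forall b Z', (Z' <= Z)%nat ->
    Rabs (rsum (fun n => psi (y / (INR n + 0) - b)) (seq 1 Z')) <= K * Rpower y (1 / 3 + s)).
  { intros b Z' HZ'; apply Hpsi; [exact Hy|lra|].
    intros n Hn; eapply Rle_trans; [apply pow_incr|exact HZy].
    pose proof (pos_INR n); rewrite Rplus_0_r; split; [lra|apply le_INR; lia]. }
  assert (Hi : 0 < / INR d) by (apply Rinv_0_lt_compat; lra).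
  (* Here the sum stops at [Z - 1], so that [n + 1 / d <= Z] stays within the square root of [y]. *)
  assert (H1 : Rabs (rsum (fun n => psi (y / (INR n + / INR d) - 0)) (seq 1 (Z - 1)))
               <= K * Rpower y (1 / 3 + s)).
  { apply Hpsi; [exact Hy|lra|].
    intros n Hn; eapply Rle_trans; [apply pow_incr|exact HZy].
    assert (/ INR d <= 1) by (rewrite <- Rinv_1; apply Rinv_le_contravar; lra).
    assert (INR (S n) <= INR Z) by (apply le_INR; lia).
    rewrite S_INR in *; pose proof (pos_INR n); lra. }
  pose proof (quot_count_near N d Z ltac:(lia) HZN) as E1.
  pose proof (quot_count_far N d Z Hd HZ) as E2.
  rewrite floor_diff_sum in E2 by lia.
  pose proof (density_tail N d M Z Hd HM HZ) as E3.
  fold y in E1, E2.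
  assert (EC : quot_count N d = rsum (fun n => dvd d (N / n)) (seq 1 Z)
                + rsum (fun n => dvd d (N / n)) (seq (S Z) (N - Z))).
  { rewrite <- rsum_app; change (S Z) with (1 + Z)%nat; rewrite <- seq_app.
    replace (Z + (N - Z))%nat with N by lia; reflexivity. }
  assert (HyM : (N / d <= M / d)%nat) by (apply Nat.Div0.div_le_mono; exact HM).
  assert (HZM : (Z <= N / d)%nat) by nia.
  assert (ED : quot_density M d = rsum (pronic_inv d) (seq 1 (Z - 1))
                + rsum (pronic_inv d) (seq Z (M / d + 1 - Z))).
  { rewrite quot_density_pronic by lia.
    replace (M / d)%nat with ((Z - 1) + (M / d + 1 - Z))%nat at 1 by lia.
    rewrite seq_app, rsum_app; do 3 f_equal; lia. }
  pose proof (H0 (/ INR d) Z (le_n Z)) as P1. pose proof (H0 0 Z (le_n Z)) as P2.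
  pose proof (H0 0 (Z - 1)%nat ltac:(lia)) as P3.
  assert (HR : 1 <= Rpower y (1 / 3 + s)) by (apply Rpower_ge_1; lra).
  rewrite EC, ED, E1.
  apply Rabs_le_between in H1, P1, P2, P3, E3.
  apply Rabs_le; lra.
Qed.

(** For [d > N] the count vanishes and [N] times the density is at most [2 N / d^2 <= 2 / d].
    Covering every [d] allows summation up to any truncation point. *)
Lemma quot_count_error (s : R) : 0 < s -> exists K : R, 0 <= K /\
  forall N d M : nat, (1 <= d)%nat -> (1 <= N <= M)%nat ->
  Rabs (quot_count N d - INR N * quot_density M d)
    <= K * (Rpower (INR N) (1 / 3 + s) * Rpower (INR d) (- (1 / 3))).
Proof.
  intros Hs; destruct (quot_count_asymptotic s Hs) as (K & HK & Hcount).
  exists (K + 2); split; [lra|].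
  intros N d M Hd HN.
  assert (Hd1 : 1 <= INR d) by (apply (le_INR 1); lia).
  assert (HN1 : 1 <= INR N) by (apply (le_INR 1); lia).
  assert (HX : 0 < Rpower (INR N) (1 / 3 + s) * Rpower (INR d) (- (1 / 3)))
    by (apply Rmult_lt_0_compat; apply Rpower_pos).
  destruct (le_lt_dec d N) as [L|L].
  - eapply Rle_trans; [apply Hcount; lia|].
    apply Rle_trans with (K * (Rpower (INR N) (1 / 3 + s) * Rpower (INR d) (- (1 / 3))));
      [|nra].
    apply Rmult_le_compat_l; [exact HK|].
    unfold Rdiv at 1; rewrite <- Rpower_mult_distr by (try apply Rinv_0_lt_compat; lra).
    apply Rmult_le_compat_l; [left; apply Rpower_pos|].
    rewrite <- (Rpower_1 (INR d)) at 1 by lra.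
    rewrite <- Rpower_Ropp, Rpower_mult; apply Rpower_mono; lra.
  - rewrite quot_count_large by exact L.
    destruct (quot_density_bounds M d Hd) as [D1 D2].
    assert (HNd : INR N <= INR d) by (apply le_INR; lia).
    rewrite Rabs_left1 by nra.
    apply Rle_trans with (2 * (Rpower (INR N) (1 / 3 + s) * Rpower (INR d) (- (1 / 3)))); [|nra].
    apply Rle_trans with (INR N * (2 / INR d ^ 2)); [nra|].
    replace (INR N * (2 / INR d ^ 2)) with (2 * (INR N / INR d ^ 2)) by (field; lra).
    apply Rmult_le_compat_l; [lra|].
    apply Rle_trans with (1 * Rpower (INR d) (- (1 / 3))).
    + rewrite Rmult_1_l; apply Rle_trans with (Rpower (INR d) (- (1))).
      * rewrite Rpower_Ropp, Rpower_1 by lra.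
        replace (INR N / INR d ^ 2) with (INR N / INR d * / INR d) by (field; lra).
        rewrite <- (Rmult_1_l (/ INR d)) at 2.
        apply Rmult_le_compat_r; [left; apply Rinv_0_lt_compat; lra|].
        apply Rle_div_l; lra.
      * apply Rpower_mono; lra.
    + apply Rmult_le_compat_r; [left; apply Rpower_pos|]. apply Rpower_ge_1; lra.
Qed.

(** * Complex sums and the series *)

(** The same fold as in [id_conv] and [floor_sum], which are thus instances of it by conversion. *)
Definition csum {A : Type} (F : A -> C) (l : list A) : C :=
  fold_right Cplus (RtoC 0) (map F l).

Lemma csum_components {A} (F : A -> C) l :
  csum F l = (rsum (fun x => fst (F x)) l, rsum (fun x => snd (F x)) l).
Proof.
  induction l as [|x l IH]; [reflexivity|].
  change (csum F (x :: l)) with (Cplus (F x) (csum F l)).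
  rewrite IH; reflexivity.
Qed.

Lemma csum_ext {A} (F G : A -> C) l : (forall x, In x l -> F x = G x) -> csum F l = csum G l.
Proof.
  intros H; rewrite !csum_components.
  f_equal; apply rsum_ext; intros x Hx; rewrite H by exact Hx; reflexivity.
Qed.

Lemma csum_app {A} (F : A -> C) l l' : csum F (l ++ l') = Cplus (csum F l) (csum F l').
Proof. rewrite !csum_components, !rsum_app; reflexivity. Qed.

Lemma csum_switch {A B} (F : A -> B -> C) l l' :
  csum (fun x => csum (F x) l') l = csum (fun y => csum (fun x => F x y) l) l'.
Proof.
  rewrite !csum_components.
  f_equal; [rewrite (rsum_ext _ (fun x => rsum (fun y => fst (F x y)) l'))
           |rewrite (rsum_ext _ (fun x => rsum (fun y => snd (F x y)) l'))];
    try (intros; rewrite csum_components; reflexivity);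
    rewrite rsum_switch; apply rsum_ext; intros; rewrite csum_components; reflexivity.
Qed.

Lemma csum_scal_l {A} (c : C) (F : A -> C) l :
  csum (fun x => Cmult c (F x)) l = Cmult c (csum F l).
Proof.
  rewrite !csum_components; unfold Cmult; simpl.
  rewrite rsum_minus, rsum_plus, !rsum_scal; reflexivity.
Qed.

Lemma csum_RtoC_scal {A} (w : A -> R) (c : C) l :
  csum (fun x => Cmult (RtoC (w x)) c) l = Cmult (RtoC (rsum w l)) c.
Proof.
  rewrite csum_components; unfold Cmult, RtoC; simpl.
  f_equal.
  - rewrite (rsum_ext _ (fun x => fst c * w x)) by (intros; ring). rewrite rsum_scal; ring.
  - rewrite (rsum_ext _ (fun x => snd c * w x)) by (intros; ring). rewrite rsum_scal; ring.
Qed.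

(** Brings both the floor sum and the partial series to the form of a sum of [g e] with real
    weights. *)
Lemma csum_exchange_weights {A B} (w : A -> B -> R) (g : B -> C) l l' :
  csum (fun n => csum (fun e => Cmult (RtoC (w n e)) (g e)) l') l
  = csum (fun e => Cmult (RtoC (rsum (fun n => w n e) l)) (g e)) l'.
Proof. rewrite csum_switch; apply csum_ext; intros; apply csum_RtoC_scal. Qed.

Lemma csum_minus {A} (F G : A -> C) l :
  csum (fun x => Cminus (F x) (G x)) l = Cminus (csum F l) (csum G l).
Proof.
  rewrite !csum_components; unfold Cminus, Cplus, Copp; simpl.
  f_equal; [exact (rsum_minus (fun x => fst (F x)) (fun x => fst (G x)) l)
           |exact (rsum_minus (fun x => snd (F x)) (fun x => snd (G x)) l)].
Qed.

Lemma Cmod_csum {A} (F : A -> C) l : Cmod (csum F l) <= rsum (fun x => Cmod (F x)) l.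
Proof.
  induction l as [|x l IH]; [unfold csum, rsum; simpl; rewrite Cmod_0; lra|].
  change (csum F (x :: l)) with (Cplus (F x) (csum F l)).
  rewrite rsum_cons; eapply Rle_trans; [apply Cmod_triangle|lra].
Qed.

Lemma csum_indic_eq (F : nat -> C) (j A len : nat) : (A <= j < A + len)%nat ->
  csum (fun k => Cmult (RtoC (indic (k =? j)%nat)) (F k)) (seq A len) = F j.
Proof.
  intros Hj; rewrite csum_components; unfold Cmult, RtoC; simpl.
  rewrite (surjective_pairing (F j)); f_equal.
  - rewrite <- (rsum_indic_eq (fun k => fst (F k)) j A len Hj).
    apply rsum_ext; intros; ring.
  - rewrite <- (rsum_indic_eq (fun k => snd (F k)) j A len Hj).
    apply rsum_ext; intros; ring.
Qed.

Lemma sum_n_csum (a : nat -> C) k :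
  @sum_n C_AbelianMonoid (fun i => a (S i)) k = csum a (seq 1 (S k)).
Proof.
  induction k as [|k IH].
  - rewrite sum_O; unfold csum; simpl; symmetry; apply Cplus_0_r.
  - rewrite sum_Sn, IH, (seq_S (S k)), csum_app.
    change (plus (csum a (seq 1 (S k))) (a (S (S k))))
      with (Cplus (csum a (seq 1 (S k))) (a (S (S k)))).
    unfold csum at 3; simpl; rewrite Cplus_0_r; reflexivity.
Qed.

(** Here [e = m / d] is the complementary divisor, and [d / m = 1 / e]. The range is extended to a
    common [M] so that all [m] share one index set. *)
Lemma id_conv_div (g : nat -> C) (m M : nat) : (1 <= m <= M)%nat ->
  Cdiv (id_conv g m) (RtoC (INR m))
  = csum (fun e => Cmult (RtoC (dvd e m * / INR e)) (g e)) (seq 1 M).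
Proof.
  intros Hm.
  assert (Hm0 : 0 < INR m) by (apply lt_0_INR; lia).
  unfold id_conv; fold (csum (fun d => if (m mod d =? 0)%nat
    then Cmult (RtoC (INR d)) (g (m / d)%nat) else RtoC 0) (seq 1 m)).
  rewrite (csum_ext _ (fun d => csum (fun e =>
    Cmult (RtoC (indic (m =? d * e)%nat * INR d)) (g e)) (seq 1 M))).
  - rewrite csum_exchange_weights.
    unfold Cdiv; rewrite Cmult_comm, <- csum_scal_l.
    apply csum_ext; intros e He; apply in_seq in He.
    assert (He0 : 0 < INR e) by (apply lt_0_INR; lia).
    rewrite (rsum_ext _ (fun d => INR m / INR e * indic (m =? d * e)%nat)).
    + rewrite rsum_scal, <- dvd_as_count; try lia.
      2:{ apply Nat.Div0.div_le_upper_bound; nia. }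
      rewrite Cmult_assoc, <- RtoC_inv, <- RtoC_mult; [|lra..].
      do 2 f_equal; field; lra.
    + intros d _; destruct (Nat.eqb_spec m (d * e)) as [E|E]; simpl; [|ring].
      rewrite E, mult_INR; field; lra.
  - intros d Hd; apply in_seq in Hd.
    pose proof (Nat.div_mod m d ltac:(lia)) as E.
    destruct (Nat.eqb_spec (m mod d) 0) as [E0|E0].
    + assert (Hq : (1 <= m / d < 1 + M)%nat) by (split; [destruct (m / d)%nat; lia|nia]).
      rewrite <- (csum_indic_eq (fun e => Cmult (RtoC (INR d)) (g e)) (m / d) 1 M Hq).
      apply csum_ext; intros e _; rewrite RtoC_mult, <- Cmult_assoc.
      do 3 f_equal; apply Bool.eq_true_iff_eq; rewrite !Nat.eqb_eq; split; intros; nia.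
    + rewrite (csum_ext _ (fun e => Cmult (RtoC 0) (g e))).
      * rewrite csum_scal_l, Cmult_0_l; reflexivity.
      * intros e _; destruct (Nat.eqb_spec m (d * e)) as [Ek|]; simpl; [|rewrite Rmult_0_l; reflexivity].
        exfalso; apply E0; rewrite Ek, Nat.mul_comm; apply Nat.Div0.mod_mul.
Qed.

(* Coquelicot exports another [nfloor]. *)
Local Notation nfloor := Defs.nfloor.

(** * Both sides as weighted sums of g *)

Lemma nfloor_bounds x : 0 <= x -> INR (nfloor x) <= x < INR (nfloor x) + 1.
Proof.
  intros Hx; unfold nfloor; destruct (base_Int_part x) as [I1 I2].
  assert (0 <= Int_part x)%Z by (apply Z.lt_succ_r, lt_IZR; rewrite succ_IZR; lra).
  rewrite INR_IZR_INZ, Z2Nat.id by assumption; lra.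
Qed.

Lemma nfloor_div x n : 0 <= x -> (1 <= n)%nat -> nfloor (x / INR n) = (nfloor x / n)%nat.
Proof.
  intros Hx Hn.
  assert (Hn0 : 0 < INR n) by (apply lt_0_INR; lia).
  destruct (nfloor_bounds x Hx) as [B1 B2].
  destruct (nfloor_bounds (x / INR n)) as [D1 D2]; [apply Rdiv_le_0_compat; lra|].
  set (k := nfloor (x / INR n)) in *. set (N := nfloor x) in *.
  apply (Rle_div_r _ _ _ Hn0) in D1. apply (Rlt_div_l _ _ _ Hn0) in D2.
  assert (k * n <= N)%nat.
  { apply Nat.lt_succ_r, INR_lt; rewrite S_INR, mult_INR; lra. }
  assert (N < (k + 1) * n)%nat.
  { apply INR_lt; rewrite mult_INR, plus_INR, INR_1; lra. }
  apply Nat.div_unique with (N - n * k)%nat; nia.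
Qed.

Lemma floor_sum_quot_count (g : nat -> C) (x : R) (M : nat) : 0 <= x -> (nfloor x <= M)%nat ->
  floor_sum (id_conv g) x
  = csum (fun e => Cmult (RtoC (quot_count (nfloor x) e * / INR e)) (g e)) (seq 1 M).
Proof.
  intros Hx HM; set (N := nfloor x) in *.
  transitivity (csum (fun n => csum (fun e =>
    Cmult (RtoC (dvd e (N / n) * / INR e)) (g e)) (seq 1 M)) (seq 1 N)).
  - unfold floor_sum; fold N; apply csum_ext; intros n Hn; apply in_seq in Hn.
    cbv zeta; rewrite nfloor_div by (lra || lia); fold N.
    apply id_conv_div; split; [apply Nat.div_le_lower_bound; lia|].
    apply Nat.le_trans with N; [apply Nat.Div0.div_le_upper_bound; nia|exact HM].
  - rewrite csum_exchange_weights; apply csum_ext; intros e _.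
    do 2 f_equal; unfold quot_count; rewrite Rmult_comm, <- rsum_scal.
    apply rsum_ext; intros; ring.
Qed.

Definition series_term (g : nat -> C) (m : nat) : C :=
  Cdiv (id_conv g m) (RtoC (INR m ^ 2 * (INR m + 1))).

Lemma series_term_expand (g : nat -> C) (m M : nat) : (1 <= m <= M)%nat ->
  series_term g m = csum (fun e =>
    Cmult (RtoC (dvd e m * / (INR m * (INR m + 1)) * / INR e)) (g e)) (seq 1 M).
Proof.
  intros Hm.
  assert (Hm0 : 0 < INR m) by (apply lt_0_INR; lia).
  assert (0 < INR m * (INR m + 1)) by nra.
  transitivity (Cmult (RtoC (/ (INR m * (INR m + 1)))) (Cdiv (id_conv g m) (RtoC (INR m)))).
  - unfold series_term, Cdiv.
    assert (INR m ^ 2 * (INR m + 1) <> 0)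
      by (apply Rmult_integral_contrapositive_currified; [apply pow_nonzero|]; lra).
    rewrite <- !RtoC_inv by (assumption || lra).
    replace (/ (INR m ^ 2 * (INR m + 1))) with (/ (INR m * (INR m + 1)) * / INR m)
      by (field; lra).
    rewrite RtoC_mult; ring.
  - rewrite (id_conv_div g m M Hm), <- csum_scal_l; apply csum_ext; intros e _.
    rewrite Cmult_assoc, <- RtoC_mult; do 2 f_equal; ring.
Qed.

Lemma partial_series_quot_density (g : nat -> C) (M : nat) :
  csum (series_term g) (seq 1 M)
  = csum (fun e => Cmult (RtoC (quot_density M e * / INR e)) (g e)) (seq 1 M).
Proof.
  rewrite (csum_ext _ (fun m => csum (fun e =>
    Cmult (RtoC (dvd e m * / (INR m * (INR m + 1)) * / INR e)) (g e)) (seq 1 M)))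
    by (intros m Hm; apply in_seq in Hm; apply series_term_expand; lia).
  rewrite csum_exchange_weights; apply csum_ext; intros e _.
  do 2 f_equal; unfold quot_density; rewrite Rmult_comm, <- rsum_scal.
  apply rsum_ext; intros; ring.
Qed.

(** After interchanging the sums, the density bound [2 / e^2] and [|g e| / e <= K] leave [2 K] times
    a sum of [1 / e^2], itself at most 2. *)
Lemma rsum_Cmod_series_term_le (g : nat -> C) (K : R) (M : nat) :
  (forall n, (1 <= n)%nat -> Cmod (g n) <= K * INR n) ->
  rsum (fun m => Cmod (series_term g m)) (seq 1 M) <= 4 * K.
Proof.
  intros Hg.
  assert (HK : 0 <= K).
  { specialize (Hg 1%nat (le_n _)); simpl in Hg; pose proof (Cmod_ge_0 (g 1%nat)); lra. }
  apply Rle_trans with (rsum (fun e => quot_density M e * (/ INR e * Cmod (g e))) (seq 1 M)).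
  - apply Rle_trans with (rsum (fun m => rsum (fun e =>
      (/ INR e * Cmod (g e)) * (dvd e m * / (INR m * (INR m + 1)))) (seq 1 M)) (seq 1 M)).
    + apply rsum_le; intros m Hm; apply in_seq in Hm.
      rewrite (series_term_expand g m M) by lia.
      eapply Rle_trans; [apply Cmod_csum|].
      apply rsum_le; intros e He; apply in_seq in He.
      assert (0 < INR m) by (apply lt_0_INR; lia).
      assert (0 < / INR e) by (apply Rinv_0_lt_compat, lt_0_INR; lia).
      assert (0 < / (INR m * (INR m + 1))) by (apply Rinv_0_lt_compat; nra).
      rewrite Cmod_mult, Cmod_R, Rabs_pos_eq; [lra|].
      repeat apply Rmult_le_pos; try lra. apply indic_bounds.
    + rewrite rsum_switch; apply rsum_le; intros e _.
      rewrite rsum_scal, Rmult_comm; apply Rle_refl.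
  - apply Rle_trans with (rsum (fun e => 2 * K * Rpower (INR e) (-1 - 1)) (seq 1 M)).
    + apply rsum_le; intros e He; apply in_seq in He.
      assert (He0 : 0 < INR e) by (apply lt_0_INR; lia).
      destruct (quot_density_bounds M e ltac:(lia)) as [D1 D2].
      assert (G : / INR e * Cmod (g e) <= K).
      { specialize (Hg e ltac:(lia)).
        apply Rmult_le_reg_l with (INR e); [exact He0|].
        rewrite <- Rmult_assoc, Rinv_r by lra; lra. }
      assert (0 <= / INR e * Cmod (g e))
        by (apply Rmult_le_pos; [left; apply Rinv_0_lt_compat; lra|apply Cmod_ge_0]).
      replace (-1 - 1) with (- INR 2) by (simpl; ring).
      rewrite Rpower_Ropp, Rpower_pow by exact He0.
      replace (2 * K * / INR e ^ 2) with (2 / INR e ^ 2 * K) by (field; lra).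
      apply Rmult_le_compat; assumption.
    + rewrite rsum_scal.
      pose proof (rsum_zeta_le 1 M ltac:(lra)) as Zt. rewrite Rinv_1 in Zt. nra.
Qed.

(** * Convergence of the series and the final estimate *)

Lemma ex_series_C_abs (a : nat -> C) (B : R) :
  (forall n, rsum (fun m => Cmod (a m)) (seq 1 n) <= B) ->
  exists L : C, is_series (fun k => a (S k)) L.
Proof.
  intros HB.
  apply (@ex_series_le _ C_CompleteNormedModule (fun k => a (S k)) (fun k => Cmod (a (S k)))).
  - intros k; apply Rle_refl.
  - assert (E : forall k, sum_n (fun k => Cmod (a (S k))) k
                  = rsum (fun m => Cmod (a m)) (seq 1 (S k))).
    { induction k as [|k IH]; [rewrite sum_O; unfold rsum; simpl; ring|].
      rewrite sum_Sn, IH, (rsum_seq_S _ 1 (S k)); reflexivity. }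
    destruct (ex_finite_lim_seq_incr (sum_n (fun k => Cmod (a (S k)))) B) as [l Hl].
    + intros k; rewrite sum_Sn; unfold plus; simpl.
      pose proof (Cmod_ge_0 (a (S (S k)))); lra.
    + intros k; rewrite E; apply HB.
    + exists l; exact Hl.
Qed.

(** An estimate uniform in the truncation point passes to the limit, so only finite sums need to be
    compared. *)
Lemma Cmod_affine_series_le (a : nat -> C) (L S0 : C) (x B : R) (k0 : nat) : 0 <= x ->
  is_series (fun k => a (S k)) L ->
  (forall M, (k0 <= M)%nat -> Cmod (Cminus S0 (Cmult (RtoC x) (csum a (seq 1 M)))) <= B) ->
  Cmod (Cminus S0 (Cmult (RtoC x) L)) <= B.
Proof.
  intros Hx HL HB; apply le_epsilon; intros eps Heps.
  (* Dividing by [x + 1] rather than [x] includes the case [x = 0]. *)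
  assert (Hd : 0 < eps / (x + 1)) by (apply Rdiv_lt_0_compat; lra).
  destruct (proj1 (filterlim_locally_ball_norm (sum_n (fun k => a (S k))) L) HL
              (mkposreal _ Hd)) as [k1 Hk1].
  set (k := (k0 + k1)%nat).
  specialize (Hk1 k ltac:(unfold k; lia)); specialize (HB (S k) ltac:(unfold k; lia)).
  unfold ball_norm in Hk1; rewrite sum_n_csum in Hk1; simpl pos in Hk1.
  change (norm (minus (csum a (seq 1 (S k))) L))
    with (Cmod (Cminus (csum a (seq 1 (S k))) L)) in Hk1.
  set (s := csum a (seq 1 (S k))) in *.
  replace (Cminus S0 (Cmult (RtoC x) L))
    with (Cplus (Cminus S0 (Cmult (RtoC x) s)) (Cmult (RtoC x) (Cminus s L))) by ring.
  eapply Rle_trans; [apply Cmod_triangle|].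
  rewrite Cmod_mult, Cmod_R, (Rabs_pos_eq x) by exact Hx.
  assert (x * Cmod (Cminus s L) <= eps).
  { apply Rle_trans with ((x + 1) * (eps / (x + 1))); [|right; field; lra].
    pose proof (Cmod_ge_0 (Cminus s L)). apply Rmult_le_compat; lra. }
  lra.
Qed.

(** The error at [e] carries [e^(-1/3) e^(-1) e^(1/6) = e^(-7/6)], whose sum is at most
    [1 + 6 = 7]. *)
Lemma floor_sum_partial_series (g : nat -> C) (eps Kg : R) : 0 < eps ->
  (forall n, (1 <= n)%nat -> Cmod (g n) <= Kg * Rpower (INR n) (1 / 6)) ->
  exists K, 0 <= K /\ forall (x : R) (M : nat), 1 <= x -> (nfloor x <= M)%nat ->
    Cmod (Cminus (floor_sum (id_conv g) x)
            (Cmult (RtoC (INR (nfloor x))) (csum (series_term g) (seq 1 M))))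
      <= K * Rpower (INR (nfloor x)) (1 / 3 + eps).
Proof.
  intros Heps Hg; destruct (quot_count_error eps Heps) as (K & HK & Herr).
  assert (HKg : 0 <= Kg).
  { specialize (Hg 1%nat (le_n _)); simpl in Hg; pose proof (Cmod_ge_0 (g 1%nat)).
    unfold Rpower in Hg; rewrite ln_1, Rmult_0_r, exp_0 in Hg; lra. }
  exists (7 * (K * Kg)); split; [apply Rmult_le_pos; [lra|apply Rmult_le_pos; assumption]|].
  intros x M Hx HM.
  assert (HN : (1 <= nfloor x)%nat).
  { destruct (nfloor_bounds x ltac:(lra)).
    apply Nat.lt_succ_r, INR_lt; rewrite (S_INR (nfloor x)), INR_1; lra. }
  rewrite (floor_sum_quot_count g x M) by (lra || assumption).
  rewrite partial_series_quot_density, <- csum_scal_l, <- csum_minus.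
  set (N := nfloor x) in *. set (X := Rpower (INR N) (1 / 3 + eps)).
  assert (HX : 0 < X) by apply Rpower_pos.
  eapply Rle_trans; [apply Cmod_csum|].
  apply Rle_trans with (rsum (fun e => K * Kg * X * Rpower (INR e) (-1 - 1 / 6)) (seq 1 M)).
  - apply rsum_le; intros e He; apply in_seq in He.
    assert (He0 : 0 < INR e) by (apply lt_0_INR; lia).
    replace (Cminus (Cmult (RtoC (quot_count N e * / INR e)) (g e))
               (Cmult (RtoC (INR N)) (Cmult (RtoC (quot_density M e * / INR e)) (g e))))
      with (Cmult (RtoC ((quot_count N e - INR N * quot_density M e) * / INR e)) (g e)).
    2:{ rewrite Rmult_minus_distr_r, RtoC_minus, Rmult_assoc, !(RtoC_mult (INR N)); ring. }
    rewrite Cmod_mult, Cmod_R, Rabs_mult, (Rabs_pos_eq (/ INR e))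
      by (left; apply Rinv_0_lt_compat; exact He0).
    apply Rle_trans with ((K * (X * Rpower (INR e) (- (1 / 3))) * / INR e)
                          * (Kg * Rpower (INR e) (1 / 6))).
    + apply Rmult_le_compat; [|apply Cmod_ge_0| |apply Hg; lia].
      * apply Rmult_le_pos; [apply Rabs_pos|left; apply Rinv_0_lt_compat; exact He0].
      * apply Rmult_le_compat_r; [left; apply Rinv_0_lt_compat; exact He0|].
        apply Herr; lia.
    + right.
      replace (/ INR e) with (Rpower (INR e) (- (1)))
        by (rewrite Rpower_Ropp, Rpower_1 by exact He0; reflexivity).
      replace (-1 - 1 / 6) with (- (1 / 3) + - (1) + 1 / 6) by lra.
      rewrite !Rpower_plus; ring.
  - rewrite rsum_scal.
    pose proof (rsum_zeta_le (1 / 6) M ltac:(lra)) as Zt.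
    replace (1 + / (1 / 6)) with 7 in Zt by field.
    replace (7 * (K * Kg) * X) with (K * Kg * X * 7) by ring.
    apply Rmult_le_compat_l; [|exact Zt].
    apply Rmult_le_pos; [apply Rmult_le_pos; assumption|lra].
Qed.

(* The series sum_{m >= 1} f(m)/(m^2 (m+1)) is indexed by k >= 0 with m = k+1. *)
Theorem theorem1p2 (g : nat -> C)
  (hg : forall eps : R, 0 < eps ->
        exists K : R, forall n : nat, (1 <= n)%nat ->
          Cmod (g n) <= K * Rpower (INR n) eps) :
  exists L : C,
    is_series (fun k : nat => let m := Datatypes.S k in
                 Cdiv (id_conv g m) (RtoC (INR m ^ 2 * (INR m + 1)))) L /\
    forall eps : R, 0 < eps ->
      exists (Cst x0 : R), forall x : R, x0 <= x ->
        Cmod (Cminus (floor_sum (id_conv g) x) (Cmult (RtoC x) L))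
          <= Cst * Rpower x (1/3 + eps).
Proof.
  (* Exponent 1 serves the absolute convergence, exponent [1 / 6] the error term; neither depends on
     the final [eps], so [L] is fixed first. *)
  destruct (hg 1 Rlt_0_1) as [K1 HK1].
  destruct (hg (1 / 6) ltac:(lra)) as [Kg HKg].
  destruct (ex_series_C_abs (series_term g) (4 * K1)) as [L HL].
  { intros M; apply rsum_Cmod_series_term_le; intros n Hn.
    rewrite <- (Rpower_1 (INR n)) by (apply lt_0_INR; lia); apply HK1, Hn. }
  exists L; split; [exact HL|].
  intros eps Heps.
  destruct (floor_sum_partial_series g eps Kg Heps HKg) as (K & HK & Hpart).
  exists (K + Cmod L), 1; intros x Hx.
  destruct (nfloor_bounds x ltac:(lra)) as [B1 B2].
  set (N := nfloor x) in *.
  assert (HN : 0 < INR N) by lra.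
  assert (P : Cmod (Cminus (floor_sum (id_conv g) x) (Cmult (RtoC (INR N)) L))
              <= K * Rpower (INR N) (1 / 3 + eps)).
  { apply (Cmod_affine_series_le (series_term g) L _ _ _ N); [lra|exact HL|].
    intros M HM; apply Hpart; assumption. }
  (* Passing from the integral part [N] back to [x] costs at most [|L|]. *)
  replace (Cminus (floor_sum (id_conv g) x) (Cmult (RtoC x) L))
    with (Cplus (Cminus (floor_sum (id_conv g) x) (Cmult (RtoC (INR N)) L))
                (Cmult (RtoC (INR N - x)) L)) by (rewrite RtoC_minus; ring).
  eapply Rle_trans; [apply Cmod_triangle|].
  rewrite Cmod_mult, Cmod_R, Rmult_plus_distr_r.
  apply Rplus_le_compat.
  - eapply Rle_trans; [exact P|].
    apply Rmult_le_compat_l; [exact HK|]. apply Rle_Rpower_l; lra.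
  - rewrite Rmult_comm; apply Rmult_le_compat_l; [apply Cmod_ge_0|].
    apply Rle_trans with 1; [apply Rabs_le; lra|apply Rpower_ge_1; lra].
Qed.
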